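(* Let $k,\lambda,\beta>0$ with $\lambda/k=n$ for some integer $n\ge 1$, and let $X$ be a $\Gamma$-OU$(k,\lambda,\beta)$ process. For $s\ge 0$ and $t>0$, the transition density $p(x,t+s\,|\,y,s)$ of $X$ (the generalized density in $x$ of the law of $X(t+s)$ conditional on $X(s)=y$) is $$p(x,t+s\,|\,y,s)=g_a(x-ay,n,\beta),\qquad a=e^{-kt},$$ where $$g_a(x,n,\beta)=a^n\delta(x)+\sum_{j=1}^n\binom{n}{j}a^{n-j}(1-a)^j f_{j,\beta}(x).$$
   Context: A $\Gamma$-OU$(k,\lambda,\beta)$ process is the solution of $dX(t)=-kX(t)\,dt+dZ(t)$, $X(0)=x_0$, where $Z(t)=\sum_{n=1}^{N(t)}J_n$ is a compound Poisson process: $N$ is a Poisson process with intensity $\lambda$ and the jumps $J_n$ are i.i.d. exponential with rate $\beta$, independent of $N$. Equivalently, $X(t)=x_0e^{-kt}+\sum_{n=1}^{N(t)}e^{-k(t-\tau_n)}J_n$ with $\tau_n$ the jump times of $N$. Here $f_{j,\beta}(x)=\frac{\beta}{(j-1)!}(\beta x)^{j-1}e^{-\beta x}$ for $x>0$ (and $0$ otherwise) is the density of the Erlang law with shape $j$ and rate $\beta$, and $\delta$ is the Dirac delta at $0$, so a term $c\,\delta(x)$ denotes an atom of mass $c$ at $0$. *)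

(* Defs.v *)
From HB Require Import structures.
From mathcomp Require Import all_boot all_order all_algebra.
From mathcomp Require Import all_classical all_reals all_analysis.

Set Implicit Arguments.
Unset Strict Implicit.
Unset Printing Implicit Defensive.

Import Order.TTheory GRing.Theory Num.Theory.
Import numFieldNormedType.Exports.

Local Open Scope classical_set_scope.
Local Open Scope ring_scope.

Section independence.
Context d (T : measurableType d) (R : realType) (P : probability T R).

Definition mutually_independent (I : eqType) d' (T' : measurableType d')
    (X : I -> T -> T') : Prop :=
  forall (s : seq I) (A : I -> set T'), uniq s ->
    (forall i, measurable (A i)) ->
    P (\bigcap_(i in [set` s]) (X i @^-1` A i)) =
    (\prod_(i <- s) P (X i @^-1` A i))%E.

Definition sigma_of (I : Type) (D : set I) d' (T' : measurableType d')
    (X : I -> T -> T') : set (set T) :=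
  <<s \bigcup_(i in D) preimage_set_system setT (X i) measurable >>.

Definition independent_systems (F G : set (set T)) : Prop :=
  forall A B, F A -> G B -> P (A `&` B) = (P A * P B)%E.

End independence.

Section gamma_OU.
Context d (T : measurableType d) (R : realType) (P : probability T R).

(* Path properties are only required almost surely.  The increments
   [N t w - N s w] use truncated subtraction on nat, which is harmless because
   almost all paths are nondecreasing.  The measure [poisson_prob r 0] does not
   depend on its second argument and is the Dirac mass at 0 when [r = 0]. *)
Record poisson_process (lambda : R) (N : R -> {RV P >-> nat}) : Prop := {
  poisson_paths : {ae P, forall w,
    [/\ N 0 w = 0%N,
        forall s t, 0 <= s -> s <= t -> (N s w <= N t w)%N
      & forall t, 0 <= t -> \forall u \near t^'+, N u w = N t w]} ;
  poisson_independent_increments : forall u : nat -> R,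
    0 <= u 0%N -> (forall i, u i <= u i.+1) ->
    mutually_independent P (fun i w => (N (u i.+1) w - N (u i) w)%N) ;
  poisson_increments : forall s t, 0 <= s -> s <= t ->
    forall A : set nat,
      P [set w | A (N t w - N s w)%N] = poisson_prob (lambda * (t - s)) 0 A
}.

(* [N] counts jumps and [J i] is the (i+1)-th jump of the driving compound
   Poisson process. *)
Record jump_data (lambda beta : R) (N : R -> {RV P >-> nat})
    (J : nat -> {RV P >-> R}) : Prop := {
  jump_count : poisson_process lambda N ;
  jump_law : forall i (A : set R), measurable A ->
    distribution P (J i) A = exponential_prob beta A ;
  jump_independent : mutually_independent P (fun i => J i : T -> R) ;
  jump_count_independent : independent_systems P
    (sigma_of [set t : R | 0 <= t] (fun t => N t : T -> nat))
    (sigma_of [set: nat] (fun i => J i : T -> R))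
}.

Definition compound (N : R -> {RV P >-> nat}) (J : nat -> {RV P >-> R})
    (t : R) (w : T) : R := \sum_(i < N t w) J i w.

(* Integral form of dX(t) = - k X(t) dt + dZ(t), X(0) = x0. *)
Definition OU_solution (k x0 : R) (Z : R -> T -> R) (X : R -> {RV P >-> R}) :
    Prop :=
  {ae P, forall w, forall t, 0 <= t ->
    lebesgue_measure.-integrable `[0, t] (fun u => (X u w)%:E) /\
    X t w = x0 - k * (\int[lebesgue_measure]_(u in `[0, t]) X u w) + Z t w}.

Definition gamma_OU (k lambda beta x0 : R) (X : R -> {RV P >-> R}) : Prop :=
  exists N J, jump_data lambda beta N J /\ OU_solution k x0 (compound N J) X.

End gamma_OU.

Section generalized_density.
Context (R : realType).

(* The generalized function [gd_mass * delta(x - gd_loc) + gd_reg x]. *)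
Record gen_density := GenDensity {
  gd_mass : R ; gd_loc : R ; gd_reg : R -> R }.

(* The function x |-> g(x - c). *)
Definition gd_shift (c : R) (g : gen_density) : gen_density :=
  GenDensity (gd_mass g) (gd_loc g + c) (fun x => gd_reg g (x - c)).

Definition has_gen_density (mu : set R -> \bar R) (g : gen_density) : Prop :=
  measurable_fun setT (gd_reg g) /\
  forall A : set R, measurable A ->
    mu A = ((gd_mass g)%:E * \d_(gd_loc g) A +
            \int[lebesgue_measure]_(x in A) (gd_reg g x)%:E)%E.

Definition erlang_pdf (j : nat) (beta x : R) : R :=
  if 0 < x then
    beta / (j.-1)`!%:R * (beta * x) ^+ j.-1 * expR (- (beta * x))
  else 0.

Definition g_density (a : R) (n : nat) (beta : R) : gen_density :=
  GenDensity (a ^+ n) 0 (fun x =>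
    \sum_(1 <= j < n.+1)
      'C(n, j)%:R * a ^+ (n - j) * (1 - a) ^+ j * erlang_pdf j beta x).

End generalized_density.

Section transition_density.
Context d (T : measurableType d) (R : realType) (P : probability T R).

(* [K] is a regular version of the conditional law of [Y] given [X]. *)
Definition conditional_law (X Y : {RV P >-> R}) (K : R.-pker R ~> R) : Prop :=
  forall A B : set R, measurable A -> measurable B ->
    P (X @^-1` B `&` Y @^-1` A) = (\int[distribution P X]_(y in B) K y A)%E.

(* [p y] is the generalized density p(., t + s | y, s). *)
Definition transition_density (X : R -> {RV P >-> R}) (s t : R)
    (p : R -> gen_density R) : Prop :=
  exists K : R.-pker R ~> R,
    conditional_law (X s) (X (t + s)) K /\
    forall y, has_gen_density (K y) (p y).

End transition_density.

(* Main.v *)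
Require Import Defs.

(** Set [W = X (t + s) - a X s] and [U = X s - exp (- k s) x0].  The integral
    equation and the monotonicity of the driving path [Z] give, for [u <= v],
    [exp (- k (v - u)) (Z v - Z u) <= X v - exp (- k (v - u)) X u <= Z v - Z u],
    so that on a fine grid [p U + q W] lies between two weighted sums of
    increments of [Z].  The Laplace transforms of such sums are explicit products
    of [exp (- lambda h c / (beta + c))].  Because [lambda = k n], convexity of
    [exp] puts the factor [((beta + c exp (- k h)) / (beta + c)) ^ n] between
    consecutive terms of these products; refining the grid yields
    [E exp (- p U - q W) = G_s(p) G_t(q)] with
    [G_r(q) = ((beta + q exp (- k r)) / (beta + q)) ^ n].  The binomial formula
    identifies [G_t] as the transform of the atom-plus-Erlang mixture, and
    uniqueness of Laplace transforms makes [W] independent of [X s] with that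
    law. *)

From HB Require Import structures.
From mathcomp Require Import all_boot all_order all_algebra.
From mathcomp Require Import all_classical all_reals all_analysis.
From mathcomp Require Import measurable_realfun lra ring.
Set Implicit Arguments.
Unset Strict Implicit.
Unset Printing Implicit Defensive.
Import Order.TTheory GRing.Theory Num.Theory.
Import numFieldNormedType.Exports.
Local Open Scope classical_set_scope.
Local Open Scope ring_scope.

(** * Integrals against weights *)

Section weighted_transfer.
Local Open Scope ereal_scope.
Import HBNNSimple.
Context (R : realType) d' (T' : measurableType d').

(** The solution is never written down explicitly and nothing is conditioned on jump times: a path
    enters only through two-sided bounds by increments of [Z], whose transforms have a closed form.
    The squeeze closes because the two bounding products have the same factors up to a shift of one
    index. The other obstacle is independence, a statement about a pair, while the Laplace inversion
    below concerns one variable and uses integer arguments only. Weights bridge this: the identity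
    is inverted in [U] for each fixed weight [exp (- j W)], and the resulting tail identities are
    inverted in [W] with the indicator of an event of [U] as weight. Hence integrals of [f (X)]
    against a weight [Y] are the basic objects. The atom is handled in the inversion itself: its
    mass adds the same constant to all transforms, the approximating polynomials vanish at
    [1 = exp (- 0)], so the constant drops out, and the atom is recovered from the total mass. *)

Lemma weighted_simple_integral d (T : measurableType d)
    (mu : {measure set T -> \bar R}) (Y : T -> R) (X : T -> T')
    (g : {nnsfun T' >-> R}) :
  measurable_fun setT Y -> (forall x, 0 <= Y x)%R -> measurable_fun setT X ->
  \int[mu]_x (Y x * g (X x))%:E =
  \sum_(r \in range g) r%:E * \int[mu]_(x in X @^-1` (g @^-1` [set r])) (Y x)%:E.
Proof.
move=> mY Y0 mX.
have mYE : measurable_fun setT (fun x => (Y x)%:E) by exact/measurable_EFinP.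
have mpre r : measurable (X @^-1` (g @^-1` [set r])).
  by rewrite -[X in measurable X]setTI; apply: mX => //; exact: measurable_sfunP.
have mind r : measurable_fun setT (fun x => (r * \1_(g @^-1` [set r]) (X x))%:E).
  apply/measurable_EFinP; apply: measurable_funM => //.
  by apply: (measurableT_comp _ mX).
transitivity (\int[mu]_x (\sum_(r \in range g)
    (r * \1_(g @^-1` [set r]) (X x))%:E * (Y x)%:E)).
  apply: eq_integral => x _; rewrite -ge0_mule_fsuml; last first.
    by move=> r; rewrite EFinM; exact: nnfun_muleindic_ge0.
  by rewrite fsumEFin// -fimfunE -EFinM mulrC.
rewrite ge0_integral_fsum//; last 2 first.
- by move=> r; exact: emeasurable_funM.
- move=> r x _; apply: mule_ge0; last by rewrite lee_fin.
  by rewrite EFinM nnfun_muleindic_ge0.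
apply: eq_fsbigr => r /[!inE] -[t _ <-].
under eq_integral do rewrite EFinM -muleA.
have r0 : 0 <= (g t)%:E by rewrite lee_fin.
rewrite ge0_integralZl//; last 2 first.
- apply: emeasurable_funM => //; apply/measurable_EFinP.
  by apply: (measurableT_comp _ mX).
- by move=> x _; rewrite mule_ge0 ?lee_fin.
congr (_ * _); rewrite [RHS]integral_mkcond; apply: eq_integral => x _.
by rewrite epatch_indic muleC.
Qed.

Lemma weighted_integral_lim d (T : measurableType d)
    (mu : {measure set T -> \bar R}) (Y : T -> R) (X : T -> T')
    (f : T' -> R) (mf : measurable_fun setT (fun x => (f x)%:E)) :
  measurable_fun setT Y -> (forall x, 0 <= Y x)%R -> measurable_fun setT X ->
  (forall x, 0 <= f x)%R ->
  \int[mu]_x (Y x * f (X x))%:E =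
  limn (fun n => \int[mu]_x (Y x * nnsfun_approx measurableT mf n (X x))%:E).
Proof.
move=> mY Y0 mX f0; rewrite -monotone_convergence//.
- apply: eq_integral => x _; apply/esym/cvg_lim => //.
  rewrite EFinM; under eq_fun do rewrite EFinM.
  apply: (@cvgeZl _ _ _ _ _ (Y x)%:E) => //.
  by apply: (@cvg_nnsfun_approx _ _ _ _ measurableT _ mf) => // y _; rewrite lee_fin.
- move=> n; apply/measurable_EFinP; apply: measurable_funM => //.
  by apply: (measurableT_comp _ mX).
- by move=> n x _; rewrite lee_fin mulr_ge0.
- move=> x _ m n mn; rewrite lee_fin ler_wpM2l//.
  exact/lefP/nd_nnsfun_approx.
Qed.

(** Monotone approximation of [f] by simple functions reduces the claim to level sets. Two uses:
    computing an expectation from a density ([Y1 = 1], [Y2] the density), and pulling a factor out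
    of an expectation ([Y2] constant). *)
Lemma weighted_transfer d1 (T1 : measurableType d1) d2 (T2 : measurableType d2)
    (mu1 : {measure set T1 -> \bar R}) (mu2 : {measure set T2 -> \bar R})
    (Y1 : T1 -> R) (Y2 : T2 -> R) (X1 : T1 -> T') (X2 : T2 -> T') (f : T' -> R) :
  measurable_fun setT Y1 -> (forall x, 0 <= Y1 x)%R ->
  measurable_fun setT Y2 -> (forall x, 0 <= Y2 x)%R ->
  measurable_fun setT X1 -> measurable_fun setT X2 ->
  measurable_fun setT f -> (forall x, 0 <= f x)%R ->
  (forall B, measurable B ->
    \int[mu1]_(x in X1 @^-1` B) (Y1 x)%:E = \int[mu2]_(x in X2 @^-1` B) (Y2 x)%:E) ->
  \int[mu1]_x (Y1 x * f (X1 x))%:E = \int[mu2]_x (Y2 x * f (X2 x))%:E.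
Proof.
move=> mY1 Y10 mY2 Y20 mX1 mX2 mf f0 eqB.
have mfE : measurable_fun setT (fun x => (f x)%:E) by exact/measurable_EFinP.
rewrite !(weighted_integral_lim _ mfE)//; congr (lim (_ @ \oo)).
apply/funext => n; rewrite !weighted_simple_integral//; apply: eq_fsbigr => r _.
by rewrite eqB//; exact: measurable_sfunP.
Qed.

End weighted_transfer.

(** * Uniqueness of Laplace transforms *)

Section laplace_uniqueness.
Context {R : realType}.

Lemma bernoulli_ineq (z : R) (K : nat) : 0 <= z <= 1 ->
  1 - K%:R * z <= (1 - z) ^+ K.
Proof.
move=> /andP[z0 z1]; elim: K => [|K IH]; first by rewrite mul0r subr0 expr0.
rewrite exprS; apply: le_trans (ler_wpM2l _ IH); last by rewrite subr_ge0.
rewrite -natr1; have : 0 <= K%:R * z ^+ 2 by rewrite mulr_ge0 ?exprn_ge0.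
by rewrite expr2; lra.
Qed.

(** The successor puts the exponent above the real number, which the limit for [v <= y] needs, and
    makes it positive, so that [threshold_poly] vanishes at 1. *)
Definition threshold_exp (y : R) (n : nat) : nat :=
  (Num.truncn (n.+1%:R * expR (n.+1%:R * y))).+1.

Definition threshold_poly (y : R) (n : nat) : {poly R} :=
  (1 - 'X ^+ n.+1) ^+ threshold_exp y n.

Lemma threshold_polyE y n z :
  (threshold_poly y n).[z] = (1 - z ^+ n.+1) ^+ threshold_exp y n.
Proof. by rewrite /threshold_poly horner_exp !hornerE. Qed.

Lemma threshold_poly_ge0_le1 y n v : 0 <= v ->
  0 <= (threshold_poly y n).[expR (- v)] <= 1.
Proof.
move=> v0; rewrite threshold_polyE.
have z0 : 0 <= expR (- v) ^+ n.+1 by rewrite exprn_ge0 ?expR_ge0.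
have z1 : expR (- v) ^+ n.+1 <= 1.
  by rewrite exprn_ile1 ?expR_ge0// -[leRHS]expR0 ler_expR oppr_le0.
by rewrite exprn_ge0 ?subr_ge0//= exprn_ile1 ?subr_ge0// lerBlDr lerDl.
Qed.

(* With z = exp (- (n+1) v) and K ~ (n+1) exp ((n+1) y), the product K z is of
   order (n+1) exp ((n+1) (y - v)): it tends to 0 if v > y and to infinity if
   v <= y. *)
Lemma threshold_poly_cvg (y v : R) : 0 <= y -> 0 <= v ->
  (threshold_poly y n).[expR (- v)] @[n --> \oo] --> ((y < v)%R%:R : R).
Proof.
move=> y0 v0.
have n0 n : 0 < n.+1%:R :> R by rewrite ltr0n.
have zE n : expR (- v) ^+ n.+1 = expR (- (n.+1%:R * v)).
  by rewrite -expRM_natl mulrN.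
have e0 n : 0 <= n.+1%:R * expR (n.+1%:R * y) by rewrite mulr_ge0 ?expR_ge0.
case: ltP => [yv|vy] /=.
- set d := v - y; have d0 : 0 < d by rewrite subr_gt0.
  (* With [K <= 2 (n+1) exp ((n+1) y)] and [exp ((n+1) d) >= ((n+1) d)^2 / 2], the product [K z] is
     at most [4 / (d^2 (n+1))]; Bernoulli's inequality does the rest. *)
  apply: (@squeeze_cvgr _ _ _ _ (fun n => 1 - 4 / d ^+ 2 * harmonic n) (fun=> 1)).
  + near=> n; have /andP[_ ->] := threshold_poly_ge0_le1 y n v0; rewrite andbT.
    rewrite threshold_polyE; apply: (le_trans _ (bernoulli_ineq _ _)); last first.
      rewrite exprn_ge0 ?expR_ge0//= exprn_ile1 ?expR_ge0//.
      by rewrite -[leRHS]expR0 ler_expR oppr_le0.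
    rewrite lerD2l lerN2 zE.
    have K2 : (threshold_exp y n)%:R <= 2 * (n.+1%:R * expR (n.+1%:R * y)).
      rewrite /threshold_exp -natr1; have /andP[t1 _] := truncn_itv (e0 n).
      have : 1 <= n.+1%:R * expR (n.+1%:R * y).
        by apply: mulr_ege1; rewrite ?ler1n// -[leLHS]expR0 ler_expR mulr_ge0.
      by move: t1; set e := _ * expR _; lra.
    apply: (le_trans (ler_wpM2r (expR_ge0 _) K2)).
    rewrite -!mulrA -expRD.
    have -> : n.+1%:R * y - n.+1%:R * v = - (n.+1%:R * d) by rewrite /d; ring.
    have nd0 : 0 < n.+1%:R * d by rewrite mulr_gt0.
    have := @expR_ge1Dxn R (n.+1%:R * d) 1 (ltW nd0); rewrite expRN => E.
    have E' : (n.+1%:R * d) ^+ 2 / 2 <= expR (n.+1%:R * d).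
      by move: E; rewrite (_ : 2`! = 2%N)//; set e := expR _; set q := _ ^+ 2; lra.
    have : (expR (n.+1%:R * d))^-1 <= ((n.+1%:R * d) ^+ 2 / 2)^-1.
      by rewrite lef_pV2// posrE ?expR_gt0// divr_gt0// exprn_gt0.
    move=> /(ler_wpM2l (ltW (n0 n)))/(ler_wpM2l (ler0n R 2)) /le_trans; apply.
    rewrite /harmonic /= le_eqVlt; apply/orP; left; apply/eqP.
    by field; rewrite lt0r_neq0//= (gt_eqF d0).
  + rewrite -[X in _ --> X]subr0; apply: cvgB; first exact: cvg_cst.
    by rewrite -[X in _ --> X](mulr0 (4 / d ^+ 2)); apply: cvgMl_tmp; exact: cvg_harmonic.
  + exact: cvg_cst.
- apply: (@squeeze_cvgr _ _ _ _ (fun=> 0) harmonic); last 2 first.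
  + exact: cvg_cst.
  + exact: cvg_harmonic.
  near=> n; have /andP[-> _] /= := threshold_poly_ge0_le1 y n v0.
  rewrite threshold_polyE zE.
  have z1 : expR (- (n.+1%:R * v)) <= 1.
    by rewrite -[leRHS]expR0 ler_expR oppr_le0 mulr_ge0.
  have E : 1 - expR (- (n.+1%:R * v)) <= expR (- expR (- (n.+1%:R * v))).
    exact: expR_ge1Dx.
  (* Here [(1 - z)^K <= exp (- K z) <= 1 / (1 + K z)], and [K z >= n] because [v <= y]. *)
  apply: (le_trans (lerXn2r (threshold_exp y n) _ _ E)).
  + by rewrite nnegrE subr_ge0.
  + by rewrite nnegrE expR_ge0.
  rewrite /harmonic/= -expRM_natl mulrN [leLHS]expRN lef_pV2 ?posrE ?expR_gt0//.
  apply: le_trans (expR_ge1Dx _); rewrite -[leLHS]nat1r lerD2l.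
  have K1 : n.+1%:R * expR (n.+1%:R * y) <= (threshold_exp y n)%:R.
    by have := truncn_itv (e0 n) => /andP[_ /ltW].
  apply: le_trans (ler_wpM2r (expR_ge0 _) K1).
  rewrite -mulrA -expRD; apply: (@le_trans _ _ n.+1%:R); first by rewrite ler_nat.
  by rewrite ler_peMr// -[leLHS]expR0 ler_expR subr_ge0 ler_pM2l.
Unshelve. all: by end_near. Qed.

Section moments.
Local Open Scope ereal_scope.
Context d (T : measurableType d) (mu : {measure set T -> \bar R}).
Variables (Y V : T -> R).
Hypothesis Y_int : mu.-integrable setT (fun x => (Y x)%:E).
Hypothesis mV : measurable_fun setT V.
Hypothesis V0 : forall x, (0 <= V x)%R.

Let mY : measurable_fun setT Y.
Proof. by apply/measurable_EFinP; exact: measurable_int Y_int. Qed.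

Let mhorner (p : {poly R}) : measurable_fun setT (fun x => p.[expR (- V x)]).
Proof.
apply: (measurableT_comp (f := fun z => p.[z])).
  by apply: continuous_measurable_fun; exact: continuous_horner.
by apply: measurableT_comp => //; exact: measurableT_comp.
Qed.

Let moment_integrable j :
  mu.-integrable setT (fun x => (Y x * expR (- V x) ^+ j)%:E).
Proof.
apply: le_integrable Y_int => //.
  apply/measurable_EFinP; apply: measurable_funM => //.
  have := mhorner ('X^j); by under eq_fun do rewrite !hornerE.
move=> x _ /=; rewrite lee_fin normrM ler_piMr//.
rewrite ger0_norm ?exprn_ge0 ?expR_ge0// exprn_ile1 ?expR_ge0//.
by rewrite -[leRHS]expR0 ler_expR oppr_le0.
Qed.

Lemma integral_horner (p : {poly R}) :
  \int[mu]_x (Y x * p.[expR (- V x)])%:E =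
  \sum_(i < size p) (p`_i)%:E * \int[mu]_x (Y x * expR (- V x) ^+ i)%:E.
Proof.
transitivity (\int[mu]_x (\sum_(i < size p)
    (p`_i)%:E * (Y x * expR (- V x) ^+ i)%:E)).
  apply: eq_integral => x _; rewrite horner_coef mulr_sumr -sumEFin.
  by apply: eq_bigr => i _; rewrite -EFinM mulrCA.
rewrite integral_sum//; last by move=> i; apply: integrableZl.
by apply: eq_bigr => i _; rewrite integralZl.
Qed.

Lemma integral_threshold_cvg (y : R) : (0 <= y)%R ->
  (\int[mu]_x (Y x * (threshold_poly y n).[expR (- V x)])%:E) @[n --> \oo] -->
  \int[mu]_(x in [set x | y < V x]%R) (Y x)%:E.
Proof.
move=> y0; rewrite integral_mkcond.
have mS : measurable [set x | (y < V x)%R].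
  rewrite (_ : [set _ | _] = setT `&` (V @^-1` `]y, +oo[)); last first.
    by apply/seteqP; split => x /=; rewrite in_itv/= andbT// => -[].
  exact: mV.
have [] := @dominated_convergence _ _ _ mu setT measurableT
  (fun n x => (Y x * (threshold_poly y n).[expR (- V x)])%:E)
  ((fun x => (Y x)%:E) \_ [set x | (y < V x)%R]) (fun x => (`|Y x|)%:E) => //.
- by move=> n; apply/measurable_EFinP; exact: measurable_funM.
- apply/(measurable_restrictT _ _).1 => //.
  by apply: measurable_funTS; apply/measurable_EFinP.
- apply: aeW => x _; rewrite patchE mem_setE /=.
  have -> : (if (y < V x)%R then (Y x)%:E else 0) = (Y x * (y < V x)%R%:R)%:E.
    by case: ifP; rewrite ?mulr1 ?mulr0.
  apply: cvg_EFin; first exact: nearW.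
  by apply: cvgMl_tmp; apply: threshold_poly_cvg.
- exact: integrable_abse Y_int.
- apply: aeW => x n _ /=; rewrite lee_fin normrM ler_piMr//.
  by have /andP[h ?] := threshold_poly_ge0_le1 y n (V0 x); rewrite ger0_norm.
Qed.

End moments.

(** The constant [c] is the mass of an atom at 0 kept apart from [mu2]. Integrating a polynomial
    multiplies [c] by the sum of the coefficients, that is, by the value at 1, which is 0 for
    [threshold_poly]; and as [y >= 0], the tails do not meet the atom. *)
Lemma laplace_tail d1 (T1 : measurableType d1) (mu1 : {measure set T1 -> \bar R})
    d2 (T2 : measurableType d2) (mu2 : {measure set T2 -> \bar R})
    (Y1 V1 : T1 -> R) (Y2 V2 : T2 -> R) (c : R) :
  mu1.-integrable setT (fun x => (Y1 x)%:E) -> measurable_fun setT V1 ->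
  (forall x, 0 <= V1 x) ->
  mu2.-integrable setT (fun x => (Y2 x)%:E) -> measurable_fun setT V2 ->
  (forall x, 0 <= V2 x) ->
  (forall j, \int[mu1]_x (Y1 x * expR (- V1 x) ^+ j)%:E =
     c%:E + \int[mu2]_x (Y2 x * expR (- V2 x) ^+ j)%:E)%E ->
  forall y, 0 <= y ->
  (\int[mu1]_(x in [set x | y < V1 x]%R) (Y1 x)%:E =
   \int[mu2]_(x in [set x | y < V2 x]%R) (Y2 x)%:E)%E.
Proof.
move=> iY1 mV1 V10 iY2 mV2 V20 E y y0.
have E' n : (\int[mu1]_x (Y1 x * (threshold_poly y n).[expR (- V1 x)])%:E =
    \int[mu2]_x (Y2 x * (threshold_poly y n).[expR (- V2 x)])%:E)%E.
  rewrite !integral_horner//; under eq_bigr do rewrite E.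
  set p := threshold_poly y n.
  have p1 : \sum_(i < size p) p`_i = 0.
    have := threshold_polyE y n 1.
    rewrite horner_coef expr1n subrr expr0n /= => h; rewrite -[RHS]h.
    by apply: eq_bigr => i _; rewrite expr1n mulr1.
  under eq_bigr do rewrite muleDr//.
  rewrite big_split/= -[RHS]add0e; congr (_ + _)%E.
  by under eq_bigr do rewrite -EFinM; rewrite sumEFin -mulr_suml p1 mul0r.
have := integral_threshold_cvg iY1 mV1 V10 y0.
under eq_fun do rewrite E'.
by move/cvg_unique => /(_ (@ereal_hausdorff R)); apply; exact: integral_threshold_cvg.
Qed.

End laplace_uniqueness.

(** * Laplace transforms of the Erlang, exponential and Poisson laws *)

Section erlang.
Context {R : realType}.
Implicit Types (b th x : R) (i j : nat).
Local Notation mu := (@lebesgue_measure R).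

Definition erlang_term (b : R) (i : nat) (x : R) : R :=
  (b * x) ^+ i / i`!%:R * expR (- (b * x)).

(** The survival function of the Erlang law with shape [i.+1], as a partial sum of Poisson
    probabilities. Its derivative telescopes, so its negative is an antiderivative of the
    density. *)
Definition erlang_tail (b : R) (i : nat) (x : R) : R :=
  \sum_(0 <= l < i.+1) erlang_term b l x.

Lemma erlang_pdfE j b : erlang_pdf j.+1 b =
  (fun x => b * erlang_term b j x) \_ `]0, +oo[.
Proof.
apply/funext => x; rewrite /erlang_pdf patchE mem_setE in_itv/= andbT.
by case: ifP => //= x0; rewrite /erlang_term; ring.
Qed.

Lemma is_derive_erlang_term0 b x :
  is_derive x 1 (erlang_term b 0) (- (b * erlang_term b 0 x)).
Proof.
rewrite /erlang_term; under eq_fun do rewrite expr0 fact0 divr1 mul1r.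
rewrite expr0 fact0 divr1 mul1r; apply: is_derive_eq.
by rewrite !scaler1 /GRing.scale/=; ring.
Qed.

Lemma is_derive_erlang_termS b i x :
  is_derive x 1 (erlang_term b i.+1)
    (b * erlang_term b i x - b * erlang_term b i.+1 x).
Proof.
have E : erlang_term b i.+1 = (fun y => b * y) ^+ i.+1 *
    (fun y => (i.+1`!%:R)^-1 * expR (- (b * y))).
  by apply/funext => y; rewrite /erlang_term /= fctE mulrA exprfctE.
rewrite [X in is_derive _ _ X]E; apply: is_derive_eq; rewrite exprfctE /erlang_term /GRing.scale/= factS natrM exprS.
have i0 : i.+1%:R != 0 :> R by rewrite pnatr_eq0.
have f0 : i`!%:R != 0 :> R by rewrite pnatr_eq0 -lt0n fact_gt0.
by field; rewrite f0 nat1r i0.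
Qed.

Lemma erlang_tail0 b : erlang_tail b 0 = erlang_term b 0.
Proof. by apply/funext => y; rewrite /erlang_tail big_nat1. Qed.

Lemma erlang_tailS b i :
  erlang_tail b i.+1 = erlang_tail b i + erlang_term b i.+1.
Proof. by apply/funext => y; rewrite /erlang_tail big_nat_recr. Qed.

Lemma is_derive_erlang_tail b i x :
  is_derive x 1 (erlang_tail b i) (- (b * erlang_term b i x)).
Proof.
elim: i => [|i IH].
  by rewrite erlang_tail0; exact: is_derive_erlang_term0.
rewrite erlang_tailS.
have D := is_derive_erlang_termS b i x.
by apply: is_derive_eq; ring.
Qed.

Lemma continuous_erlang_term b i : continuous (erlang_term b i).
Proof.
move=> x; apply: differentiable_continuous; apply/derivable1_diffP.
case: i => [|i]; first by have [] := is_derive_erlang_term0 b x.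
by have [] := is_derive_erlang_termS b i x.
Qed.

Lemma continuous_scaled_erlang_term b i :
  continuous (fun x => b * erlang_term b i x).
Proof.
move=> x; apply: (@continuousM _ _ (fun=> b)); first exact: cst_continuous.
exact: continuous_erlang_term.
Qed.

Lemma erlang_term_cvg0 b i : 0 < b -> erlang_term b i x @[x --> +oo] --> 0.
Proof.
move=> b0.
(* The bound comes from [exp (b x) >= (b x)^(i+1) / (i+1)!]. *)
apply: (@squeeze_cvgr _ _ _ _ (fun=> 0) (fun x => i.+1%:R / b * x^-1)); last 2 first.
- exact: cvg_cst.
- rewrite -[X in _ --> X](mulr0 (i.+1%:R / b)); apply: cvgMl_tmp.
  apply: (gtr0_cvgV0 _).2; last exact: cvg_id.
  by near=> x; near: x; exact: nbhs_pinfty_gt.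
near=> x; have x0 : 0 < x by [].
have bx0 : 0 < b * x by rewrite mulr_gt0.
have f0 n : 0 < n`!%:R :> R by rewrite ltr0n fact_gt0.
rewrite /erlang_term mulr_ge0 ?expR_ge0 ?divr_ge0 ?exprn_ge0 ?(ltW bx0)//=.
rewrite expRN ler_pdivrMr ?expR_gt0//.
have := expR_ge1Dxn i (ltW bx0); set e := expR _ => e1.
have : (b * x) ^+ i.+1 / i.+1`!%:R <= e by lra.
have c0 : 0 <= i.+1%:R / b / x by rewrite !divr_ge0 ?ltW.
move=> /(ler_wpM2l c0); apply: le_trans; rewrite le_eqVlt; apply/orP; left.
apply/eqP; rewrite factS natrM exprS.
have i0 : i.+1%:R != 0 :> R by rewrite pnatr_eq0.
by field; rewrite nat1r i0 (gt_eqF (f0 i)) (gt_eqF b0) (gt_eqF x0).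
Unshelve. all: by end_near. Qed.

Lemma erlang_tail_cvg0 b i : 0 < b -> erlang_tail b i x @[x --> +oo] --> 0.
Proof.
move=> b0; elim: i => [|i IH].
  by rewrite erlang_tail0; exact: erlang_term_cvg0.
by rewrite erlang_tailS -[0]addr0; apply: cvgD => //; exact: erlang_term_cvg0.
Qed.

Lemma erlang_term_ge0 b i x : 0 <= b -> 0 <= x -> 0 <= erlang_term b i x.
Proof.
by move=> b0 x0; rewrite mulr_ge0 ?expR_ge0// divr_ge0// exprn_ge0// mulr_ge0.
Qed.

Lemma erlang_pdf_ge0 b j x : 0 <= b -> 0 <= erlang_pdf j.+1 b x.
Proof.
move=> b0; rewrite erlang_pdfE; apply: restrict_ge0 => y.
by rewrite /= in_itv/= andbT => /ltW y0; rewrite mulr_ge0 ?erlang_term_ge0.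
Qed.

Lemma measurable_erlang_pdf b j : measurable_fun setT (erlang_pdf j.+1 b).
Proof.
rewrite erlang_pdfE; apply/(measurable_restrictT _ _).1 => //; apply: measurable_funTS.
apply: continuous_measurable_fun; exact: continuous_scaled_erlang_term.
Qed.

Lemma integral_erlang_pdf b j : 0 < b ->
  (\int[mu]_x (erlang_pdf j.+1 b x)%:E = 1)%E.
Proof.
move=> b0; rewrite erlang_pdfE.
transitivity (\int[mu]_(x in `]0%R, +oo[) (b * erlang_term b j x)%:E)%E.
  by rewrite [RHS]integral_mkcond; apply: eq_integral => x _; rewrite !patchE; case: ifP.
have cf := @continuous_scaled_erlang_term b j.
rewrite integral_itv_obnd_cbnd; last first.
  apply/measurable_EFinP; apply: measurable_funTS.
  exact: continuous_measurable_fun.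
rewrite (@ge0_continuous_FTC2y _ _ (fun x => - erlang_tail b j x) _ 0).
- rewrite /erlang_tail big_nat_recl//= big1_seq; last first.
    by move=> i _; rewrite /erlang_term mulr0 exprS !mul0r.
  by rewrite /erlang_term mulr0 expr0 fact0 divr1 oppr0 expR0 mul1r addr0 -EFinB opprK add0r.
- by move=> x x0; rewrite mulr_ge0 ?erlang_term_ge0// ltW.
- exact: continuous_subspaceT.
- by rewrite -oppr0; apply: cvgN; exact: erlang_tail_cvg0.
- by move=> x _; apply: derivableN; have [] := is_derive_erlang_tail b j x.
- apply: cvgN; apply: cvg_at_right_filter.
  apply: differentiable_continuous; apply/derivable1_diffP.
  by have [] := is_derive_erlang_tail b j 0.
- move=> x _; rewrite derive1E.
  have D := is_derive_erlang_tail b j x.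
  by rewrite deriveN// derive_val opprK.
Qed.

(** Exponential tilting stays in the Erlang family and raises the rate to [b + th], so the transform
    is read off from the normalization. The exponent [j.-1.+1] is [j], except at [j = 0], where
    [erlang_pdf] agrees with shape 1. *)
Lemma erlang_pdf_expR b j th x : 0 < b -> 0 <= th ->
  erlang_pdf j b x * expR (- (th * x)) =
  (b / (b + th)) ^+ j.-1.+1 * erlang_pdf j (b + th) x.
Proof.
move=> b0 th0; rewrite /erlang_pdf; case: ifP => _; last by rewrite mul0r mulr0.
have bt : b + th != 0 by rewrite gt_eqF// ltr_pwDl.
have -> : (b + th) * x = b * x + th * x by ring.
rewrite opprD expRD exprMn expr_div_n !exprS.
have f0 : j.-1`!%:R != 0 :> R by rewrite pnatr_eq0 -lt0n fact_gt0.
have e0 : (b + th) ^+ j.-1 != 0 by rewrite expf_neq0.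
have -> : (b * x + th * x) ^+ j.-1 = (b + th) ^+ j.-1 * x ^+ j.-1.
  by rewrite -exprMn; congr (_ ^+ _); ring.
by field; rewrite e0 bt f0.
Qed.

Lemma laplace_erlang b j th : 0 < b -> 0 <= th ->
  (\int[mu]_x (erlang_pdf j.+1 b x * expR (- (th * x)))%:E =
   ((b / (b + th)) ^+ j.+1)%:E)%E.
Proof.
move=> b0 th0; have bt : 0 < b + th by rewrite ltr_pwDl.
under eq_integral do rewrite erlang_pdf_expR// EFinM.
rewrite ge0_integralZl_EFin//.
- by rewrite integral_erlang_pdf// mule1.
- by move=> x _; rewrite lee_fin erlang_pdf_ge0// ltW.
- by apply/measurable_EFinP; exact: measurable_erlang_pdf.
- by rewrite exprn_ge0// divr_ge0// ltW.
Qed.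

Lemma laplace_exponential b th : 0 < b -> 0 <= th ->
  (\int[mu]_x (exponential_pdf b x * expR (- (th * x)))%:E = (b / (b + th))%:E)%E.
Proof.
move=> b0 th0; have bt : 0 < b + th by rewrite ltr_pwDl.
transitivity (\int[mu]_x ((b / (b + th))%:E * (exponential_pdf (b + th) x)%:E))%E.
  apply: eq_integral => x _; rewrite -EFinM; congr EFin.
  have [x0|x0] := ltP x 0; first by rewrite !lt0_exponential_pdf// mul0r mulr0.
  rewrite !exponential_pdfE// -mulrA -expRD !mulrA divfK ?gt_eqF//.
  by congr (_ * expR _); ring.
rewrite ge0_integralZl_EFin//.
- by rewrite integral_exponential_pdf// mule1.
- by move=> x _; rewrite lee_fin exponential_pdf_ge0// ltW.
- by apply/measurable_EFinP; exact: measurable_exponential_pdf.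
- by rewrite divr_ge0// ltW.
Qed.

End erlang.

Section poisson.
Context {R : realType}.
Local Open Scope ereal_scope.

Lemma poisson_generating (l r : R) : (0 <= l)%R -> (0 <= r)%R ->
  \int[@poisson_prob R l 0]_k (r ^+ k)%:E = (expR (- (l * (1 - r))))%:E.
Proof.
move=> l0 r0; have [l_gt0|] := ltP 0%R l; last first.
  move=> l_le0; have -> : l = 0%R by apply/le_anti; rewrite l_le0.
  rewrite mul0r oppr0 expR0.
  rewrite (eq_measure_integral (\d_0%N)).
    by rewrite integral_dirac// diracT mul1e expr0.
  by move=> A _ _; rewrite /= /poisson_prob ltxx.
have pm0 := @poisson_pmf_ge0 R l.
have mN (f : nat -> R) : measurable_fun setT f by [].
(* The Poisson law is the counting measure weighted by its mass function, which turns the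
   expectation into an exponential series. *)
have := @weighted_transfer R _ nat _ nat _ nat (poisson_prob l 0) counting
  (fun=> 1%R) (poisson_pmf l) id id (fun k => r ^+ k)%R.
under eq_integral do rewrite mul1r.
move=> ->//; last 2 first.
- by move=> k; rewrite exprn_ge0.
- move=> B _; rewrite integral_cst//= mul1e integral_mkcond ge0_integral_count; last first.
    by move=> k; rewrite patchE; case: ifP; rewrite ?lee_fin.
  rewrite /poisson_prob l_gt0 esum_mkcond -nneseries_esumT//.
  by move=> k; case: ifP; rewrite ?lee_fin.
rewrite ge0_integral_count; last by move=> k; rewrite lee_fin mulr_ge0 ?exprn_ge0.
rewrite (@eq_eseriesr _ _
    (fun k => (expR (- l))%:E * (exp_coeff (l * r) k)%:E)); last first.
  move=> k _; rewrite -EFinM; congr EFin.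
  by rewrite /poisson_pmf l_gt0 /exp_coeff /= exprMn; ring.
have lr0 : (0 <= l * r)%R by rewrite mulr_ge0.
rewrite nneseriesZl; last first.
  by move=> k _; rewrite lee_fin /exp_coeff/= divr_ge0// exprn_ge0.
have -> : \sum_(k <oo) (exp_coeff (l * r) k)%:E = (expR (l * r))%:E.
  rewrite expRE -EFin_lim; last first.
    rewrite /pseries/=; under eq_fun do rewrite mulrC.
    exact: is_cvg_series_exp_coeff.
  apply/congr_lim/funext => m /=; rewrite /pseries/= /series/= -sumEFin//.
  by apply: eq_bigr => i _; rewrite /exp_coeff/= mulrC.
rewrite -EFinM -expRD; congr (expR _)%:E; ring.
Qed.

End poisson.

(** * Independence *)

Section expectation_of_products.
Local Open Scope ereal_scope.
Context d (T : measurableType d) (R : realType) (P : probability T R).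
Context (I : eqType) d' (T' : measurableType d').
Variables (X : I -> T -> T') (f : I -> T' -> R).
Hypothesis mX : forall i, measurable_fun setT (X i).
Hypothesis mf : forall i, measurable_fun setT (f i).
Hypothesis f01 : forall i y, (0 <= f i y <= 1)%R.

(** Stated for a weight and not for an event, so that it survives the induction in
    [expectation_prod], which absorbs the factors into the weight one at a time. *)
Definition weight_independent (Y : T -> R) (s : seq I) :=
  forall B : I -> set T', (forall i, measurable (B i)) ->
    \int[P]_(x in \bigcap_(i in [set` s]) (X i @^-1` B i)) (Y x)%:E =
    (\int[P]_x (Y x)%:E) * \prod_(i <- s) P (X i @^-1` B i).

Let mfX i : measurable_fun setT (fun x => f i (X i x)).
Proof. exact: measurableT_comp. Qed.

Let mpre i B : measurable B -> measurable (X i @^-1` B).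
Proof. by move=> mB; rewrite -[X in measurable X]setTI; exact: mX. Qed.

Lemma expectation_prod (Y : T -> R) (s : seq I) : uniq s ->
  P.-integrable setT (fun x => (Y x)%:E) -> (forall x, (0 <= Y x)%R) ->
  weight_independent Y s ->
  \int[P]_x (Y x * \prod_(i <- s) f i (X i x))%:E =
  (\int[P]_x (Y x)%:E) * \prod_(i <- s) \int[P]_x (f i (X i x))%:E.
Proof.
elim: s Y => [|j s IH] Y /=.
  move=> _ _ _ _; rewrite big_nil mule1.
  by under eq_integral do rewrite big_nil mulr1.
move=> /andP[js us] iY Y0 indY.
have f0 i y : (0 <= f i y)%R by have /andP[] := f01 i y.
have f1 i y : (f i y <= 1)%R by have /andP[] := f01 i y.
have mY : measurable_fun setT Y by apply/measurable_EFinP; exact: measurable_int iY.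
pose Y' x := (Y x * f j (X j x))%R.
have mY' : measurable_fun setT Y' by exact: measurable_funM.
have Y'0 x : (0 <= Y' x)%R by rewrite mulr_ge0.
have iY' : P.-integrable setT (fun x => (Y' x)%:E).
  apply: le_integrable iY => //; first exact/measurable_EFinP.
  by move=> x _; rewrite /= lee_fin !ger0_norm// ler_piMr.
have fin_prob (A : set T) : measurable A -> P A \is a fin_num.
  by move=> mA; exact: fin_num_measure.
(* The enlarged weight [Y'] is still independent of the remaining variables: weighted by [Y] on the
   event [A], the law of [X j] is a constant multiple of its law under [P], and [weighted_transfer]
   with that constant weight splits off [f j]. *)
have key (B : I -> set T') : (forall i, measurable (B i)) ->
    \int[P]_(x in \bigcap_(i in [set` s]) (X i @^-1` B i)) (Y' x)%:E =
    ((\int[P]_x (Y x)%:E) * \prod_(i <- s) P (X i @^-1` B i)) *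
    \int[P]_x (f j (X j x))%:E.
  move=> mB; set A := \bigcap_(i in _) _.
  have mA : measurable A.
    by apply: fin_bigcap_measurable => // i _; exact: mpre.
  set C := (\int[P]_x (Y x)%:E) * _.
  have Cfin : C \is a fin_num.
    rewrite fin_numM//; first exact: integrable_fin_num.
    by rewrite prode_fin_num// => i _; apply/fin_prob/mpre.
  have C0 : 0 <= C.
    rewrite mule_ge0//; first by apply: integral_ge0 => x _; rewrite lee_fin.
    exact: prode_ge0.
  have mI : measurable_fun setT (\1_A : T -> R) by [].
  transitivity (\int[P]_x (Y x * \1_A x * f j (X j x))%:E).
    rewrite integral_mkcond; apply: eq_integral => x _.
    rewrite patchE indicE; case: (x \in A); rewrite ?mulr1//.
    by rewrite mulr0 mul0r.
  rewrite (@weighted_transfer _ _ _ _ T _ T P P _ (fun=> fine C) (X j) (X j))//.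
  - under eq_integral do rewrite EFinM; rewrite ge0_integralZl_EFin//.
    + by rewrite fineK.
    + by move=> x _; rewrite lee_fin.
    + by apply/measurable_EFinP; exact: mfX.
    + exact: fine_ge0.
  - exact: measurable_funM.
  - by move=> x; rewrite mulr_ge0.
  - by move=> x; exact: fine_ge0.
  - move=> Bj mBj.
    pose B' i := if i == j then Bj else B i.
    have mB' i : measurable (B' i) by rewrite /B'; case: ifP.
    have B's i : i \in s -> B' i = B i.
      by rewrite /B'; case: eqP => // ->; rewrite (negbTE js).
    transitivity (\int[P]_(x in \bigcap_(i in [set` j :: s]) (X i @^-1` B' i)) (Y x)%:E).
      rewrite [LHS]integral_mkcond [RHS]integral_mkcond.
      apply: eq_integral => x _; rewrite !patchE indicE.
      have -> : (x \in \bigcap_(i in [set` j :: s]) (X i @^-1` B' i)) =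
                (x \in X j @^-1` Bj) && (x \in A).
        apply/idP/andP => [|[]]; rewrite !inE => xB.
        + split.
            by have := xB j; rewrite /= mem_head /B' eqxx; apply.
          by move=> i /= si; have := xB i; rewrite /= in_cons si orbT B's//; apply.
        + move=> xA i; rewrite /= in_cons => /orP[/eqP ->|si].
            by rewrite /B' eqxx.
          by rewrite B's//; exact: xA.
      by case: (x \in _); case: (x \in A) => //=; rewrite ?mulr1 ?mulr0.
    rewrite indY// integral_cst ?fineK//; last exact: mpre.
    rewrite /C big_cons /B' eqxx -!muleA; congr (_ * _); rewrite muleC; congr (_ * _).
    by apply: eq_big_seq => i /B's; rewrite /B' => ->.
have eY' : \int[P]_x (Y' x)%:E =
    (\int[P]_x (Y x)%:E) * \int[P]_x (f j (X j x))%:E.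
  have := key (fun=> setT) (fun=> measurableT).
  under eq_bigr do rewrite preimage_setT probability_setT.
  rewrite big1// mule1 => <-; congr (integral _ _ _).
  by apply/esym; rewrite -subTset => x _ i _.
transitivity (\int[P]_x (Y' x * \prod_(i <- s) f i (X i x))%:E).
  by apply: eq_integral => x _; rewrite big_cons mulrA.
rewrite IH//; first by rewrite eY' big_cons muleA.
move=> B mB; rewrite key// eY' -!muleA; congr (_ * _).
by rewrite muleC.
Qed.

End expectation_of_products.

(** * Increments of the compound Poisson process *)

Section block_rates.
Context (R : realType) (m : nat) (c : nat -> R).
Implicit Types K : nat -> nat.

(** With [K i = N (u i)], the jump of index [j] occurs in the time interval [i] whose block contains
    [j], and the sum is the coefficient [c i] multiplying this jump, or 0 if no block contains
    it. *)
Definition block_rate K (j : nat) : R :=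
  \sum_(i < m) (if (K i <= j < K i.+1)%N then c i else 0).

Lemma eq_block_rate K K' j :
  (forall i, (i <= m)%N -> (K i <= j)%N = (K' i <= j)%N) ->
  block_rate K j = block_rate K' j.
Proof.
move=> KK'; apply: eq_bigr => i _.
by rewrite !ltnNge !KK'// ltnW.
Qed.

Lemma block_rate_ge0 K j : (forall i, 0 <= c i) -> 0 <= block_rate K j.
Proof. by move=> c0; apply: sumr_ge0 => i _; case: ifP. Qed.

Lemma sum_block_rate K L (x : nat -> R) :
  (forall i, (K i <= K i.+1)%N) -> (forall i, (i <= m)%N -> (K i <= L)%N) ->
  \sum_(0 <= j < L) block_rate K j * x j =
  \sum_(i < m) c i * (\sum_(j < K i.+1) x j - \sum_(j < K i) x j).
Proof.
move=> Kinc KL; under eq_bigr do rewrite mulr_suml.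
rewrite exchange_big/=; apply: eq_bigr => i _.
have [Ki1 Ki2] := (KL i (ltnW (ltn_ord i)), KL i.+1 (ltn_ord i)).
rewrite -!(big_mkord xpredT) (@big_cat_nat _ _ _ (K i) 0 (K i.+1))//= addrAC subrr add0r.
rewrite (@big_cat_nat _ _ _ (K i) 0 L)//= (@big_cat_nat _ _ _ (K i.+1) (K i) L)//=.
rewrite big_nat big1 ?add0r; last first.
  by move=> j /andP[_ jK]; rewrite leqNgt jK mul0r.
rewrite addrC big_nat big1 ?add0r; last first.
  by move=> j /andP[jK _]; rewrite [(j < _)%N]ltnNge jK andbF mul0r.
rewrite mulr_sumr big_nat [RHS]big_nat.
by apply: eq_bigr => j ->.
Qed.

(* At most one block contains a given index, so a function [r] with [r 0 = 1]
   takes sums over the blocks to products. *)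
Lemma prod_block_rate K L (r : R -> R) :
  {homo K : i j / (i <= j)%N} -> (forall i, (i <= m)%N -> (K i <= L)%N) -> r 0 = 1 ->
  \prod_(0 <= j < L) r (block_rate K j) =
  \prod_(i < m) r (c i) ^+ (K i.+1 - K i).
Proof.
move=> Kinc KL r0.
transitivity (\prod_(0 <= j < L) \prod_(i < m)
    (if (K i <= j < K i.+1)%N then r (c i) else 1)).
  apply: eq_bigr => j _; rewrite /block_rate.
  have [/existsP[i0 i0P]|/existsPn nP] :=
    boolP [exists i : 'I_m, (K i <= j < K i.+1)%N]; last first.
    rewrite big1 ?r0; last by move=> i _; rewrite (negbTE (nP i)).
    by rewrite big1// => i _; rewrite (negbTE (nP i)).
  have H (i : 'I_m) : i != i0 -> (K i <= j < K i.+1)%N = false.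
    move=> ii0; apply/negP => iP.
    have : (i < i0)%N || (i0 < i)%N by rewrite -neq_ltn.
    move: iP i0P => /andP[a1 a2] /andP[b1 b2] /orP[]lt_i.
      by have := leq_trans a2 (leq_trans (Kinc _ _ lt_i) b1); rewrite ltnn.
    by have := leq_trans b2 (leq_trans (Kinc _ _ lt_i) a1); rewrite ltnn.
  rewrite (bigD1 i0)//= i0P big1 ?addr0; last by move=> i /H ->.
  by rewrite (bigD1 i0)//= i0P big1 ?mulr1// => i /H ->.
rewrite exchange_big/=; apply: eq_bigr => i _.
have Ki := Kinc _ _ (leqnSn i).
have [Ki1 Ki2] := (KL i (ltnW (ltn_ord i)), KL i.+1 (ltn_ord i)).
rewrite (@big_cat_nat _ _ _ (K i) 0 L)//= (@big_cat_nat _ _ _ (K i.+1) (K i) L)//=.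
rewrite big_nat big1 ?mul1r; last first.
  by move=> j /andP[_ jK]; rewrite leqNgt jK.
rewrite mulrC big_nat big1 ?mul1r; last first.
  by move=> j /andP[jK _]; rewrite [(j < _)%N]ltnNge jK andbF.
rewrite big_nat (eq_bigr (fun=> r (c i))); last by move=> j ->.
by rewrite -big_nat prodr_const_nat.
Qed.

End block_rates.

(** * Laplace transforms with finitely many jumps *)

Section finitely_many_jumps.
Context d (T : measurableType d) (R : realType) (P : probability T R).
Variables (lambda beta : R) (N : R -> {RV P >-> nat}) (J : nat -> {RV P >-> R}).
Hypotheses (beta0 : 0 < beta) (jd : jump_data lambda beta N J).

(** Jumps are nonnegative only almost surely; the positive part keeps the weight in [[0, 1]] for
    every real [y] when [c >= 0]. *)
Definition jump_weight (c y : R) : R := expR (- (c * Num.max y 0)).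

Lemma measurable_jump_weight c : measurable_fun setT (jump_weight c).
Proof.
apply: measurableT_comp => //; apply: measurableT_comp => //.
by apply: measurable_funM => //; exact: measurable_maxr.
Qed.

Lemma jump_weight_ge0_le1 c y : 0 <= c -> 0 <= jump_weight c y <= 1.
Proof.
move=> c0; rewrite expR_ge0/= -[leRHS]expR0 ler_expR oppr_le0.
by rewrite mulr_ge0// le_max lexx orbT.
Qed.

Lemma jump_laplace i c : 0 <= c ->
  (\int[P]_w (jump_weight c (J i w))%:E = (beta / (beta + c))%:E)%E.
Proof.
move=> c0; rewrite -laplace_exponential//.
have p0 x := @exponential_pdf_ge0 R beta (ltW beta0) x.
transitivity (\int[P]_w (1 * jump_weight c (J i w))%:E)%E.
  by apply: eq_integral => w _; rewrite mul1r.
rewrite (@weighted_transfer _ _ _ _ _ _ _ P (@lebesgue_measure R) (fun=> 1)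
  (exponential_pdf beta) (J i) id)//.
- apply: eq_integral => x _; rewrite /jump_weight.
  have [x0|x0] := ltP x 0; first by rewrite lt0_exponential_pdf// !mul0r.
  by [].
- exact: measurable_exponential_pdf.
- exact: measurable_jump_weight.
- by move=> x; exact: expR_ge0.
- move=> B mB; rewrite integral_cst ?mul1e; last first.
    by rewrite -[X in measurable X]setTI; exact: measurable_funP.
  exact: (jump_law jd i mB).
Qed.

Lemma jump_ge0 : {ae P, forall w, forall i, 0 <= J i w}.
Proof.
suff H i : P.-negligible (~` [set w | 0 <= J i w]).
  have := negligible_bigcup H; apply: negligibleS => w /= /existsNP[i wi].
  by exists i.
exists (J i @^-1` `]-oo, 0[); split.
- by rewrite -[X in measurable X]setTI; exact: measurable_funP.
- apply: etrans (jump_law jd i (measurable_itv `]-oo, 0[)) _.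
  rewrite /exponential_prob integral0_eq// => x; rewrite /= in_itv/= => x0.
  by rewrite lt0_exponential_pdf.
- by move=> w /=; rewrite in_itv/= => /negP; rewrite -ltNge.
Qed.

Section fixed_truncation.
Variables (m L : nat) (u c : nat -> R).
Hypotheses (u0 : forall i, 0 <= u i) (c0 : forall i, 0 <= c i).

(** Truncation at [L] leaves finitely many count vectors, so an expectation splits into a finite
    sum. Nothing is lost for jumps of index below [L]: their rates depend only on comparisons of the
    counts with that index. *)
Let grid_counts w : {ffun 'I_m.+1 -> 'I_L.+1} :=
  [ffun i : 'I_m.+1 => inord (minn (N (u i) w) L)].

Let counts_at (v : {ffun 'I_m.+1 -> 'I_L.+1}) (i : nat) : nat := v (inord i).

Let counts_event v : set T := [set w | grid_counts w = v].

Let counts_event_sigma v :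
  sigma_of [set t : R | 0 <= t] (fun t => N t : T -> nat) (counts_event v).
Proof.
have -> : counts_event v = \bigcap_(i in [set: 'I_m.+1])
    ((N (u i) : T -> nat) @^-1` [set k | inord (minn k L) = v i]).
  apply/seteqP; split => w /=.
    by move=> <- i _ /=; rewrite ffunE.
  by move=> H; apply/ffunP => i; rewrite ffunE; exact: H.
rewrite /sigma_of; set G := \bigcup_(i in _) _.
have H (i : 'I_m.+1) : @measurable _ (g_sigma_algebraType G)
    ((N (u i) : T -> nat) @^-1` [set k | inord (minn k L) = v i]).
  apply: sub_sigma_algebra; exists (u i) => //=.
  by exists [set k | inord (minn k L) = v i] => //; rewrite setTI.
exact: (@fin_bigcap_measurable _ (g_sigma_algebraType G)).
Qed.

Let measurable_counts_event v : measurable (counts_event v).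
Proof.
apply: (@smallest_sub _ _ _ measurable _ _ _ (counts_event_sigma v)).
  exact: sigma_algebra_measurable.
by move=> A /= [t _ [B mB <-]]; exact: measurable_funP.
Qed.

Let block_rate_counts w j : (j < L)%N ->
  block_rate m c (counts_at (grid_counts w)) j =
  block_rate m c (fun i => N (u i) w) j.
Proof.
move=> jL; apply: eq_block_rate => i im.
rewrite /counts_at ffunE !inordK ?ltnS// ?geq_minr//.
by rewrite geq_min [(L <= j)%N]leqNgt jL orbF.
Qed.

Let mJ i : measurable_fun setT (J i). Proof. by []. Qed.

Let jumps_sigma (B : nat -> set R) (s : seq nat) :
  (forall i, measurable (B i)) ->
  sigma_of [set: nat] (fun i => J i : T -> R)
    (\bigcap_(i in [set` s]) (J i @^-1` B i)).
Proof.
move=> mB; rewrite /sigma_of; set G := \bigcup_(i in _) _.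
have H i : @measurable _ (g_sigma_algebraType G) (J i @^-1` B i).
  by apply: sub_sigma_algebra; exists i => //=; exists (B i) => //; rewrite setTI.
by apply: (@fin_bigcap_measurable _ (g_sigma_algebraType G)) => // i _; exact: H.
Qed.

Let counts_weight_independent v :
  weight_independent P (fun i => J i : T -> R) (\1_(counts_event v)) (iota 0 L).
Proof.
move=> B mB.
have mA : measurable (\bigcap_(i in [set` iota 0 L]) (J i @^-1` B i)).
  apply: fin_bigcap_measurable => // i _.
  by rewrite -[X in measurable X]setTI; exact: mJ.
rewrite !integral_indic// setIT.
apply: etrans (jump_count_independent jd (counts_event_sigma v) (jumps_sigma _ mB)) _.
by congr (_ * _)%E; rewrite (jump_independent jd)// iota_uniq.
Qed.

(** On each event [counts_event v] the rates are constants. The event is independent of the jumps,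
    so every factor may be replaced by its expectation; both sides are split over [v] and compared
    term by term. *)
Lemma finite_jumps_laplace :
  (\int[P]_w (\prod_(0 <= j < L)
     jump_weight (block_rate m c (fun i => N (u i) w) j) (J j w))%:E =
   \int[P]_w (\prod_(0 <= j < L)
     (beta / (beta + block_rate m c (fun i => N (u i) w) j)))%:E)%E.
Proof.
have split_counts (F : (nat -> nat) -> nat -> T -> R) w :
    (forall K K' j, block_rate m c K j = block_rate m c K' j -> F K j w = F K' j w) ->
    ((\prod_(0 <= j < L) F (fun i => N (u i) w) j w)%:E =
    \sum_v (\1_(counts_event v) w * \prod_(0 <= j < L) F (counts_at v) j w)%:E)%E.
  move=> HF; rewrite sumEFin; congr EFin.
  rewrite [RHS](bigD1 (grid_counts w))//= [X in _ = _ + X]big1 ?addr0; last first.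
    by move=> v vw; rewrite ?indicE memNset ?mul0r//= => /eqP; rewrite eq_sym (negbTE vw).
  rewrite ?indicE mem_set// mul1r big_nat [RHS]big_nat; apply: eq_bigr => j /= jL.
  by apply: HF; rewrite block_rate_counts.
have E1 w := split_counts (fun K j w => jump_weight (block_rate m c K j) (J j w)) w
  (fun K K' j e => congr1 (fun x => jump_weight x (J j w)) e).
have E2 w := split_counts (fun K j w => beta / (beta + block_rate m c K j)) w
  (fun K K' j e => congr1 (fun x => beta / (beta + x)) e).
under eq_integral do rewrite E1.
under [RHS]eq_integral do rewrite E2.
have br0 K j : 0 <= block_rate m c K j by exact: block_rate_ge0.
have q0 K j : 0 <= beta / (beta + block_rate m c K j).
  by rewrite divr_ge0 ?addr_ge0// ltW.
have mI v : measurable_fun setT (\1_(counts_event v) : T -> R) by [].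
rewrite !ge0_integral_sum//; last 4 first.
- move=> v; apply/measurable_EFinP; apply: measurable_funM => //.
- by move=> v x _; rewrite lee_fin mulr_ge0// prodr_ge0.
- move=> v; apply/measurable_EFinP; apply: measurable_funM => //.
  apply: measurable_prod => j _.
  exact: measurableT_comp (measurable_jump_weight _) (mJ j).
- move=> v x _; rewrite lee_fin mulr_ge0// prodr_ge0// => j _.
  by have /andP[] := jump_weight_ge0_le1 (J j x) (br0 (counts_at v) j).
apply: eq_bigr => v _.
have := @expectation_prod _ T R P nat _ _ (fun i => J i : T -> R)
  (fun j => jump_weight (block_rate m c (counts_at v) j)) mJ
  (fun j => measurable_jump_weight _) (fun j y => jump_weight_ge0_le1 y (br0 _ j))
  (\1_(counts_event v)) (iota 0 L) (iota_uniq 0 L).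
rewrite /index_iota subn0 => ->//; last exact: integrable_indic.
rewrite [X in (_ * X)%E](eq_bigr (fun j =>
  (beta / (beta + block_rate m c (counts_at v) j))%:E)); last first.
  by move=> j _; exact: jump_laplace.
under [RHS]eq_integral do rewrite mulrC EFinM.
rewrite ge0_integralZl_EFin//.
- by rewrite muleC prodEFin.
- by apply/measurable_EFinP.
- by rewrite prodr_ge0.
Qed.

End fixed_truncation.
End finitely_many_jumps.

Section bounded_convergence.
Context d (T : measurableType d) (R : realType) (P : probability T R).

Lemma bounded_cvg_integral (F : nat -> T -> R) (G : T -> R) :
  (forall n, measurable_fun setT (F n)) -> measurable_fun setT G ->
  (forall n x, 0 <= F n x <= 1) ->
  {ae P, forall x, F n x @[n --> \oo] --> G x} ->
  (\int[P]_x (F n x)%:E)%E @[n --> \oo] --> (\int[P]_x (G x)%:E)%E.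
Proof.
move=> mF mG F01 FG.
have [] := @dominated_convergence _ _ _ P setT measurableT
  (fun n x => (F n x)%:E) (fun x => (G x)%:E) (fun=> 1%E) => //.
- by move=> n; apply/measurable_EFinP.
- by apply/measurable_EFinP.
- apply: filterS FG => x FG _; apply: cvg_EFin; first exact: nearW.
  exact: FG.
- exact: finite_measure_integrable_cst.
- apply: aeW => x n _; have /andP[F0 F1] := F01 n x.
  by rewrite /= lee_fin ger0_norm.
Qed.

End bounded_convergence.

Section compound_increments.
Context d (T : measurableType d) (R : realType) (P : probability T R).
Variables (lambda beta : R) (N : R -> {RV P >-> nat}) (J : nat -> {RV P >-> R}).
Hypotheses (lambda0 : 0 <= lambda) (beta0 : 0 < beta).
Hypothesis jd : jump_data lambda beta N J.

Lemma measurable_compound t : measurable_fun setT (compound N J t).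
Proof.
(* The number of summands is random; sums of fixed length with a cut-off at [N t w] are eventually
   equal to it at each [w]. *)
apply: (@measurable_fun_cvg _ _ _ _
  (fun L w => \sum_(0 <= j < L) (if (j < N t w)%N then J j w else 0))) => //.
  move=> L; apply: measurable_sum => j; apply: measurable_fun_ifT => //.
  exact: (measurableT_comp (f := fun k => (j < k)%N)).
move=> w _; apply: cvg_near_cst; near=> L.
have NL : (N t w <= L)%N by near: L; exact: nbhs_infty_ge.
rewrite (@big_cat_nat _ _ _ (N t w))//= [X in _ + X]big_nat [X in _ + X]big1; last first.
  by move=> j /andP[+ _]; rewrite leqNgt => /negbTE ->.
rewrite addr0 /compound -(big_mkord xpredT (fun i => J i w)) big_nat [RHS]big_nat.
by apply: eq_bigr => j /andP[_ ->].
Unshelve. all: by end_near. Qed.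

Variables (m : nat) (u c : nat -> R).
Hypotheses (u0 : 0 <= u 0%N) (u_inc : forall i, u i <= u i.+1).
Hypothesis c0 : forall i, 0 <= c i.

Let u_homo : {homo u : i j / (i <= j)%N >-> i <= j}.
Proof. by apply: homo_leq => //; exact: le_trans. Qed.

Let u_ge0 i : 0 <= u i.
Proof. by apply: (le_trans u0); apply: u_homo. Qed.

Let K w i := N (u i) w.

Let measurable_block_rate j :
  measurable_fun setT (fun w => block_rate m c (K w) j).
Proof.
rewrite /block_rate; apply: measurable_sum => i; apply: measurable_fun_ifT => //.
apply: measurable_and.
  exact: (measurableT_comp (f := fun k => (k <= j)%N)).
exact: (measurableT_comp (f := fun k => (j < k)%N)).
Qed.

(** Independence of the increments reduces this to the Poisson generating function at
    [r = beta / (beta + c i)], where [1 - r = c i / (beta + c i)]. *)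
Lemma counts_laplace :
  (\int[P]_w (\prod_(i < m) (beta / (beta + c i)) ^+ (K w i.+1 - K w i))%:E =
   (\prod_(i < m) expR (- (lambda * (u i.+1 - u i) * (c i / (beta + c i)))))%:E)%E.
Proof.
have r01 i : 0 <= beta / (beta + c i) <= 1.
  have bc : 0 < beta + c i by rewrite ltr_pwDl.
  by rewrite divr_ge0 ?(ltW beta0) ?(ltW bc)//= ler_pdivrMr// mul1r lerDl.
have I1 D : measurable D -> (\int[P]_(x in D) 1%:E = P D)%E.
  by move=> mD; rewrite integral_cst ?mul1e.
have mincr i : measurable_fun setT (fun w => (K w i.+1 - K w i)%N).
  exact: measurable_fun_subn.
have incr_law i A : P ((fun w => K w i.+1 - K w i)%N @^-1` A) =
    poisson_prob (lambda * (u i.+1 - u i)) 0 A.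
  exact: (poisson_increments (jump_count jd)).
have Kindep := poisson_independent_increments (jump_count jd) u0 u_inc.
have := @expectation_prod _ T R P nat _ nat (fun i w => (K w i.+1 - K w i)%N)
  (fun i k => (beta / (beta + c i)) ^+ k) mincr.
move=> /(_ _ _ (fun=> 1) (iota 0 m) (iota_uniq 0 m)) H.
transitivity (\int[P]_w (1 * \prod_(i <- iota 0 m)
    (beta / (beta + c i)) ^+ (K w i.+1 - K w i))%:E)%E.
  apply: eq_integral => w _; rewrite mul1r; congr EFin.
  by rewrite -(big_mkord xpredT (fun i => (beta / (beta + c i)) ^+ (K w i.+1 - K w i)))
    /index_iota subn0.
rewrite H//; last 3 first.
- by move=> i k; rewrite exprn_ge0 ?exprn_ile1//; have /andP[] := r01 i.
- exact: finite_measure_integrable_cst.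
- move=> B mB; rewrite [X in (X * _)%E]I1// [X in (X * _)%E](@probability_setT _ _ _ P) mul1e.
  rewrite I1; last first.
    apply: fin_bigcap_measurable => // i _.
    by rewrite -[X in measurable X]setTI; exact: mincr.
  by apply: Kindep => //; exact: iota_uniq.
rewrite I1// [X in (X * _)%E](@probability_setT _ _ _ P) mul1e -prodEFin.
rewrite -(big_mkord xpredT (fun i => (expR (- (lambda * (u i.+1 - u i) * (c i / (beta + c i)))))%:E)).
rewrite /index_iota subn0; apply: eq_bigr => i _.
transitivity (\int[P]_w (1 * (beta / (beta + c i)) ^+ (K w i.+1 - K w i))%:E)%E.
  by apply: eq_integral => w _; rewrite mul1r.
rewrite (@weighted_transfer _ _ _ _ _ _ _ P
  (poisson_prob (lambda * (u i.+1 - u i)) 0) (fun=> 1) (fun=> 1)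
  (fun w => K w i.+1 - K w i)%N id (fun k => (beta / (beta + c i)) ^+ k))//.
- under eq_integral do rewrite mul1r.
  have bc : 0 < beta + c i by rewrite ltr_pwDl.
  rewrite poisson_generating; last 2 first.
  + by rewrite mulr_ge0// subr_ge0.
  + by have /andP[] := r01 i.
  by congr (expR (- (_ * _)))%:E; field; rewrite gt_eqF.
- by move=> k; rewrite exprn_ge0//; have /andP[] := r01 i.
- move=> B mB; rewrite I1 ?incr_law; last first.
    by rewrite -[X in measurable X]setTI; exact: mincr.
  by rewrite integral_cst ?mul1e.
Qed.

(** Let [L] tend to infinity in [finite_jumps_laplace]. For almost every [w] both integrands are
    constant once [L] is at least [N (u m) w]: one becomes the exponential by [sum_block_rate], the
    other the product of powers by [prod_block_rate]. *)
Lemma compound_laplace :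
  (\int[P]_w (expR (- \sum_(i < m)
      c i * (compound N J (u i.+1) w - compound N J (u i) w)))%:E =
   (\prod_(i < m) expR (- (lambda * (u i.+1 - u i) * (c i / (beta + c i)))))%:E)%E.
Proof.
have br0 K' j : 0 <= block_rate m c K' j by exact: block_rate_ge0.
have q01 K' j : 0 <= beta / (beta + block_rate m c K' j) <= 1.
  have bc : 0 < beta + block_rate m c K' j by rewrite ltr_pwDl.
  by rewrite divr_ge0 ?(ltW beta0) ?(ltW bc)//= ler_pdivrMr// mul1r lerDl.
have r01 i : 0 <= beta / (beta + c i) <= 1.
  have bc : 0 < beta + c i by rewrite ltr_pwDl.
  by rewrite divr_ge0 ?(ltW beta0) ?(ltW bc)//= ler_pdivrMr// mul1r lerDl.
rewrite -counts_laplace.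
pose F L w := \prod_(0 <= j < L) jump_weight (block_rate m c (K w) j) (J j w).
pose G L w := \prod_(0 <= j < L) (beta / (beta + block_rate m c (K w) j)).
have FG L : (\int[P]_w (F L w)%:E = \int[P]_w (G L w)%:E)%E.
  exact: (finite_jumps_laplace beta0 jd).
have good : {ae P, forall w, (forall i j, (i <= j)%N -> (K w i <= K w j)%N) /\
    forall i, 0 <= J i w}.
  apply: filterS2 (poisson_paths (jump_count jd)) (jump_ge0 jd) => w [_ Ninc _] J0.
  by split=> // i j ij; apply: Ninc => //; exact: u_homo.
have mF L : measurable_fun setT (F L).
  apply: measurable_prod => j _; apply: measurableT_comp => //.
  apply: measurableT_comp => //; apply: measurable_funM => //.
  exact: measurable_maxr.
(* The absolute value, harmless on the nonnegative rates, makes the function continuous on the whole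
   line and hence measurable. *)
have cq : continuous ((fun x => beta / (beta + `|x|)) : R -> R).
  move=> x; apply: (@continuousM R R (fun=> beta) (fun y => (beta + `|y|)^-1)).
    exact: cst_continuous.
  apply: (@continuousV _ _ (fun y => beta + `|y|)).
    by rewrite gt_eqF// ltr_pwDl.
  apply: (@continuousD _ _ _ (fun=> beta)); first exact: cst_continuous.
  exact: norm_continuous.
have mG L : measurable_fun setT (G L).
  apply: measurable_prod => j _.
  rewrite (_ : (fun x => _) = (fun x => beta / (beta + `|x|)) \o
    (fun w => block_rate m c (K w) j)); last first.
    by apply/funext => w /=; rewrite ger0_norm.
  by apply: measurableT_comp => //; exact: continuous_measurable_fun.
have : (\int[P]_w (F L w)%:E)%E @[L --> \oo] --> (\int[P]_w (expR (- \sum_(i < m)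
      c i * (compound N J (u i.+1) w - compound N J (u i) w)))%:E)%E.
  apply: bounded_cvg_integral => //.
  - apply: measurableT_comp => //; apply: measurableT_comp => //.
    apply: measurable_sum => i; apply: measurable_funM => //.
    by apply: measurable_funB; exact: measurable_compound.
  - move=> L w; rewrite /F.
    have F01 j := jump_weight_ge0_le1 (J j w) (br0 (K w) j).
    by rewrite prodr_ge0 ?Num.Theory.prodr_ile1// => j _; have /andP[] := F01 j.
  - apply: filterS good => w [Kinc J0]; apply: cvg_near_cst; near=> L.
    have KL i : (i <= m)%N -> (K w i <= L)%N.
      move=> im; apply: (leq_trans (Kinc _ _ im)).
      by near: L; exact: nbhs_infty_ge.
    rewrite /F /jump_weight -expR_sum; congr expR.
    rewrite sumrN; congr (- _).
    rewrite -(sum_block_rate c (fun j => J j w) (fun i => Kinc _ _ (leqnSn i)) KL).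
    by apply: eq_bigr => j _; rewrite max_l.
under eq_fun do rewrite FG.
move/cvg_unique => /(_ (@ereal_hausdorff R)); apply.
apply: bounded_cvg_integral => //.
- apply: measurable_prod => i _.
  apply: (measurableT_comp (f := fun k => (beta / (beta + c i)) ^+ k)) => //.
  exact: measurable_fun_subn.
- move=> L w.
  by rewrite prodr_ge0 ?Num.Theory.prodr_ile1// => i _; have /andP[] := q01 (K w) i.
- apply: filterS good => w [Kinc J0]; apply: cvg_near_cst; near=> L.
  rewrite /G (@prod_block_rate R m c (K w) L (fun x => beta / (beta + x)))//.
  + move=> i im; apply: (leq_trans (Kinc _ _ im)).
    by near: L; exact: nbhs_infty_ge.
  + by rewrite addr0 divff// gt_eqF.
Unshelve. all: by end_near. Qed.

End compound_increments.

(** * Path inequalities *)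

Section path_bounds.
Context {R : realType}.
Local Notation mu := (@lebesgue_measure R).
Implicit Types (g x z : R -> R) (k u v r : R).

Lemma integrable_subitv g (a b c d : R) : a <= c -> d <= b ->
  mu.-integrable `[a, b] (fun s => (g s)%:E) ->
  mu.-integrable `[c, d] (fun s => (g s)%:E).
Proof.
move=> ac db; apply: integrableS => //.
by move=> s /=; rewrite !in_itv/= => /andP[? ?]; apply/andP; split;
  [exact: le_trans ac _|exact: le_trans db].
Qed.

Lemma Rintegral_itv_diff g (a c b : R) : a <= c -> c <= b ->
  mu.-integrable `[a, b] (fun s => (g s)%:E) ->
  \int[mu]_(s in `[a, b]) g s - \int[mu]_(s in `[a, c]) g s =
  \int[mu]_(s in `]c, b]) g s.
Proof.
by move=> ac cb ig; apply: Rintegral_itvB => //; rewrite bnd_simp.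
Qed.

(* At a negative minimum of the integral [F] of [g], the inequality
   [g >= - k F > 0] makes [F] strictly increasing just to the left. *)
Lemma integral_comparison g k u v : 0 < k -> u <= v ->
  mu.-integrable `[u, v] (fun s => (g s)%:E) ->
  (forall r, u <= r <= v -> - (k * \int[mu]_(s in `[u, r]) g s) <= g r) ->
  0 <= \int[mu]_(s in `[u, v]) g s.
Proof.
move=> k0 uv ig gF; pose F r := \int[mu]_(s in `[u, r]) g s.
have [c] := EVT_min uv (parameterized_integral_continuous uv ig).
rewrite in_itv/= => /andP[uc cv] Fmin.
apply: (@le_trans _ _ (F c)); last by apply: Fmin; rewrite in_itv/= uv lexx.
rewrite leNgt; apply/negP => Fc0.
have {uc}uc : u < c.
  rewrite lt_neqAle uc andbT; apply/eqP => uc_eq.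
  by move: Fc0; rewrite /F -uc_eq set_itv1 Rintegral_set1 ltxx.
have ic := integrable_subitv (lexx u) cv ig.
have /(continuous_within_itvP _ uc)[_ _ Fleft] :=
  parameterized_integral_continuous (ltW uc) ic.
(* As [F c < 0], the value [F c / 2] lies strictly above [F c], so continuity keeps [F] below it to
   the left of [c]; being still negative, it bounds [g] away from 0 there. *)
have Fc2 : F c < F c / 2 by lra.
have near_c : \forall s \near c^'-, F s < F c / 2 by exact: cvgr_lt Fleft _ Fc2.
have [e /= e0 Fe] := (nbhs_ballP _ _).1 near_c.
pose r1 := Num.max u (c - e / 2).
have r1c : r1 < c by rewrite gt_max uc/=; lra.
have ur1 : u <= r1 by rewrite le_max lexx.
have Fneg s : r1 < s <= c -> F s <= F c / 2.
  move=> /andP[r1s sc]; have [->|sc'] := eqVneq s c; first exact: ltW.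
  apply: ltW; apply: Fe; last by rewrite lt_neqAle sc' sc.
  rewrite /ball/= ger0_norm ?subr_ge0//.
  by move: r1s; rewrite gt_max => /andP[_ ?]; lra.
have Fdiff := Rintegral_itv_diff ur1 (ltW r1c) ic.
have Fr1 : F c <= F r1.
  by apply: Fmin; rewrite in_itv/= ur1 (le_trans (ltW r1c)).
suff : 0 < \int[mu]_(s in `]r1, c]) g s.
  by rewrite -Fdiff -/(F c) -/(F r1); lra.
apply: (@lt_le_trans _ _ (- (k * (F c / 2)) * (c - r1))).
  apply: mulr_gt0; last by rewrite subr_gt0.
  by rewrite -mulrN mulr_gt0//; lra.
have -> : - (k * (F c / 2)) * (c - r1) =
    \int[mu]_(s in `]r1, c]) (- (k * (F c / 2))).
  by rewrite Rintegral_cst//= lebesgue_measure_itv/= lte_fin r1c.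
apply: le_Rintegral => //.
- apply: measurable_bounded_integrable => //.
  + by rewrite /= lebesgue_measure_itv/= lte_fin r1c -EFinB ltry.
  + by exists `|k * (F c / 2)|; split => // M KM s _ /=; rewrite normrN ltW.
- apply: integrableS ic => // s /=; rewrite !in_itv/= => /andP[r1s ->].
  by rewrite (le_trans ur1 (ltW r1s)).
- move=> s /=; rewrite in_itv/= => r1sc; have /andP[r1s sc] := r1sc.
  apply: le_trans (gF s _); last first.
    by rewrite (le_trans ur1 (ltW r1s))/= (le_trans sc).
  by rewrite lerN2 ler_wpM2l ?(ltW k0)// Fneg.
Qed.

Lemma Rintegral_expR k u r : 0 < k -> u <= r ->
  \int[mu]_(s in `[u, r]) expR (- (k * (s - u))) =
  (1 - expR (- (k * (r - u)))) / k.
Proof.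
move=> k0; rewrite le_eqVlt => /predU1P[<-|ur].
  by rewrite set_itv1 Rintegral_set1 subrr mulr0 oppr0 expR0 subrr mul0r.
pose G s := - (expR (- (k * (s - u))) / k).
have dG s : is_derive s (1 : R) G (expR (- (k * (s - u)))).
  apply: is_derive_eq; rewrite /GRing.scale/=.
  by field; rewrite gt_eqF.
have cont (h h' : R -> R) : (forall s, is_derive s (1 : R) h (h' s)) -> continuous h.
  move=> dh s; apply: differentiable_continuous; apply/derivable1_diffP.
  by have [] := dh s.
have cG : continuous G := cont _ _ dG.
have cE : continuous (fun s => expR (- (k * (s - u)))).
  apply: (cont _ (fun s => - k * expR (- (k * (s - u))))) => s.
  by apply: is_derive_eq; rewrite /GRing.scale/=; ring.
rewrite /Rintegral (@continuous_FTC2 _ _ G)//.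
- by rewrite /= /G subrr mulr0 oppr0 expR0; ring.
- exact: continuous_subspaceT.
- split.
  + by move=> s _; have [] := dG s.
  + by apply: cvg_at_right_filter; exact: cG.
  + by apply: cvg_at_left_filter; exact: cG.
- by move=> s _; rewrite derive1E; have D := dG s; rewrite derive_val.
Qed.

(** The path is compared in integral with [x u * e] (no increment of [z]) and [(x u + zeta) * e]
    (the whole increment placed at time [u]). The difference [g], with the sign that should be
    positive, satisfies [g r + k * F r = z r - z u] or [z v - z r], where [F] is its integral from
    [u]. Both are nonnegative, so [integral_comparison] applies. *)
Lemma OU_path_bounds k (x0 : R) x z u v : 0 < k ->
  (forall t, 0 <= t -> mu.-integrable `[0, t] (fun s => (x s)%:E) /\
     x t = x0 - k * \int[mu]_(s in `[0, t]) x s + z t) ->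
  (forall s t, 0 <= s -> s <= t -> z s <= z t) -> 0 <= u -> u <= v ->
  expR (- (k * (v - u))) * (z v - z u) <= x v - expR (- (k * (v - u))) * x u
    <= z v - z u.
Proof.
move=> k0 xE zinc u0 uv.
pose e s := expR (- (k * (s - u))).
pose I r := \int[mu]_(s in `[u, r]) x s.
have ix : mu.-integrable `[u, v] (fun s => (x s)%:E).
  exact: integrable_subitv u0 (lexx v) (xE v (le_trans u0 uv)).1.
have ie : mu.-integrable `[u, v] (fun s => (e s)%:E).
  apply: continuous_compact_integrable; first exact: segment_compact.
  apply: continuous_subspaceT => s.
  apply: differentiable_continuous; apply/derivable1_diffP.
  by have [] : is_derive s (1 : R) e (- k * e s)
    by rewrite /e; apply: is_derive_eq; rewrite /GRing.scale/=; ring.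
have xr r : u <= r -> x r = x u - k * I r + (z r - z u).
  move=> ur; have r0 := le_trans u0 ur.
  have [i0r ->] := xE r r0; have [_ ->] := xE u u0.
  have -> : I r = \int[mu]_(s in `[0, r]) x s - \int[mu]_(s in `[0, u]) x s.
    rewrite Rintegral_itv_diff// /I Rintegral_itv_obnd_cbnd//.
    apply: integrableS i0r => // s /=; rewrite !in_itv/= => /andP[us ->].
    by rewrite (le_trans u0 (ltW us)).
  by ring.
pose G a b r := \int[mu]_(s in `[u, r]) (a * x s + b * e s).
have GE a b r : u <= r <= v -> G a b r = a * I r + b * ((1 - e r) / k).
  move=> /andP[ur rv].
  have ixr := integrable_subitv (lexx u) rv ix.
  have ier := integrable_subitv (lexx u) rv ie.
  rewrite /G RintegralD//; last 2 first.
  - by apply: (@integrableZl _ _ _ _ _ _ a) ixr.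
  - by apply: (@integrableZl _ _ _ _ _ _ b) ier.
  by rewrite !RintegralZl// Rintegral_expR.
have iG a b : mu.-integrable `[u, v] (fun s => (a * x s + b * e s)%:E).
  rewrite (_ : (fun s => _) = ((fun s => (a * x s)%:E) \+ (fun s => (b * e s)%:E))%E)//.
  apply: integrableD => //.
  - by apply: (@integrableZl _ _ _ _ _ _ a) ix.
  - by apply: (@integrableZl _ _ _ _ _ _ b) ie.
have kE b r : k * (b * ((1 - e r) / k)) = b * (1 - e r).
  by field; rewrite gt_eqF.
have uvv : u <= v <= v by rewrite uv lexx.
rewrite -/(e v); apply/andP; split.
- set zeta := z v - z u.
  have : 0 <= G (- 1) (zeta + x u) v.
    apply: (integral_comparison k0 uv (iG _ _)) => r urv.
    have /andP[ur rv] := urv; rewrite -/(G _ _ r) GE// (xr r)//.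
    by have := kE (zeta + x u) r; have := zinc _ _ (le_trans u0 ur) rv; rewrite /zeta; lra.
  rewrite GE// => /(mulr_ge0 (ltW k0)).
  by rewrite (xr v)//; have := kE (zeta + x u) v; rewrite -/zeta; lra.
- have : 0 <= G 1 (- x u) v.
    apply: (integral_comparison k0 uv (iG _ _)) => r urv.
    have /andP[ur rv] := urv; rewrite -/(G _ _ r) GE// (xr r)//.
    by have := kE (- x u) r; have := zinc _ _ u0 ur; lra.
  rewrite GE// => /(mulr_ge0 (ltW k0)).
  by rewrite (xr v)//; have := kE (- x u) v; lra.
Qed.

End path_bounds.

(** * Grid approximation *)

Section grid_products.
Context {R : realType}.
Variables (k lambda beta : R) (n : nat).
Hypotheses (k0 : 0 < k) (beta0 : 0 < beta) (lambdaE : lambda = k * n%:R).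
Implicit Types (c h p x w : R).

(** The tangent at [w * x], evaluated at 0 and at [x], with weights [1 - w] and [w]. *)
Lemma expR_le_convex w x : 0 <= w <= 1 -> expR (w * x) <= 1 - w + w * expR x.
Proof.
move=> /andP[w0 w1].
have e0 := expR_gt0 (w * x).
have H1 : (1 - (w * x)) * expR (w * x) <= 1.
  have := expR_ge1Dx (- (w * x)); move=> /(ler_wpM2r (ltW e0)).
  by rewrite expRN mulVf ?gt_eqF.
have H2 : (1 + (x - w * x)) * expR (w * x) <= expR x.
  have := expR_ge1Dx (x - w * x); move=> /(ler_wpM2r (ltW e0)).
  by rewrite -expRD subrK.
have w1' : 0 <= 1 - w by rewrite subr_ge0.
have := ler_wpM2l w1' H1; have := ler_wpM2l w0 H2.
by set a := expR (w * x); lra.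
Qed.

Definition step_rate c := c / (beta + c).

Lemma step_rate_ge0_le1 c : 0 <= c -> 0 <= step_rate c <= 1.
Proof.
move=> c0; have bc : 0 < beta + c by rewrite ltr_pwDl.
by rewrite divr_ge0 ?(ltW bc)//= ler_pdivrMr// mul1r lerDr ltW.
Qed.

(** The ratio equals [1 - w + w exp (- k h)] with [w = step_rate c]. With [c' = c exp (- k h)] and
    [w' = step_rate c'], its inverse equals [1 - w' + w' exp (k h)]. Convexity bounds both, and the
    power [n] turns [k h] into [lambda h]. *)
Lemma step_bounds c h : 0 <= c -> 0 <= h ->
  expR (- (lambda * h * step_rate c)) <=
  ((beta + c * expR (- (k * h))) / (beta + c)) ^+ n <=
  expR (- (lambda * h * step_rate (c * expR (- (k * h))))).
Proof.
move=> c0 h0; set c' := c * expR _.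
have c'0 : 0 <= c' by rewrite mulr_ge0 ?expR_ge0.
have bc : 0 < beta + c by rewrite ltr_pwDl.
have bc' : 0 < beta + c' by rewrite ltr_pwDl.
have lamE y : expR (- (lambda * h * y)) = expR (- (y * (k * h))) ^+ n.
  by rewrite -expRM_natl lambdaE; congr expR; ring.
have ratio0 : 0 <= (beta + c') / (beta + c) by rewrite divr_ge0// ltW.
rewrite !lamE; apply/andP; split; apply: lerXn2r; rewrite ?nnegrE ?expR_ge0//.
- have := expR_le_convex (- (k * h)) (step_rate_ge0_le1 c0); rewrite mulrN.
  move=> /le_trans; apply; rewrite le_eqVlt /step_rate /c'; apply/orP; left.
  by apply/eqP; field; rewrite gt_eqF.
- have := expR_le_convex (k * h) (step_rate_ge0_le1 c'0) => le1.
  rewrite expRN -[leLHS]invrK lef_pV2 ?posrE ?expR_gt0 ?invr_gt0 ?divr_gt0//.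
  apply: (le_trans le1); rewrite invf_div le_eqVlt; apply/orP; left; apply/eqP.
  have cE : c = c' * expR (k * h).
    by rewrite /c' expRN -mulrA mulVf ?mulr1// gt_eqF// expR_gt0.
  by rewrite [in RHS]cE /step_rate; field; rewrite gt_eqF.
Qed.

(** The transform of a grid sum: offset 0 belongs to the upper sum, with exponents [0] to [M - 1],
    and offset 1 to the lower sum, with exponents [1] to [M]. *)
Definition step_prod p h (M o : nat) : R :=
  \prod_(j < M) expR (- (lambda * h * step_rate (p * expR (- (k * h)) ^+ (j + o)))).

Lemma step_prod_ge0_le1 p h M o : 0 <= p -> 0 <= h -> 0 <= step_prod p h M o <= 1.
Proof.
move=> p0 h0; have l0 : 0 <= lambda by rewrite lambdaE mulr_ge0// ltW.
have term j : 0 <= expR (- (lambda * h * step_rate (p * expR (- (k * h)) ^+ (j + o)))) <= 1.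
  rewrite expR_ge0/= -[leRHS]expR0 ler_expR oppr_le0.
  apply: (mulr_ge0 (mulr_ge0 l0 h0)).
  have c0 : 0 <= p * expR (- (k * h)) ^+ (j + o) by rewrite mulr_ge0 ?exprn_ge0 ?expR_ge0.
  by have /andP[] := step_rate_ge0_le1 c0.
by rewrite /step_prod prodr_ge0 ?Num.Theory.prodr_ile1// => j _; have /andP[] := term j.
Qed.

(** The middle term telescopes over [p * E ^+ j], and [step_bounds] encloses each of its factors. *)
Lemma step_prod_bounds p h M : 0 <= p -> 0 <= h ->
  step_prod p h M 0 <=
  ((beta + p * expR (- (k * (h * M%:R)))) / (beta + p)) ^+ n <=
  step_prod p h M 1.
Proof.
move=> p0 h0; set E := expR (- (k * h)).
have cj0 j : 0 <= p * E ^+ j by rewrite mulr_ge0 ?exprn_ge0 ?expR_ge0.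
have bc j : beta + p * E ^+ j != 0 by rewrite gt_eqF// ltr_pwDl.
have -> : ((beta + p * expR (- (k * (h * M%:R)))) / (beta + p)) ^+ n =
    \prod_(j < M) ((beta + p * E ^+ j * E) / (beta + p * E ^+ j)) ^+ n.
  have -> : expR (- (k * (h * M%:R))) = E ^+ M.
    by rewrite -expRM_natl; congr expR; ring.
  elim: M => [|M IH].
    by have := bc 0%N; rewrite big_ord0 expr0 !mulr1 => ?; rewrite divff// expr1n.
  rewrite big_ord_recr/= -IH -exprMn -mulrA -exprSr; congr (_ ^+ n).
  by have := bc M; have := bc 0%N; rewrite expr0 mulr1 => ? ?; field; apply/andP.
rewrite /step_prod -/E; apply/andP; split; apply: ler_prod => j _.
- by rewrite expR_ge0 addn0; have /andP[] := step_bounds (cj0 j) h0.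
- rewrite exprn_ge0/=; last first.
    by rewrite divr_ge0 ?addr_ge0 ?(ltW beta0)// mulr_ge0 ?expR_ge0.
  by rewrite addn1 exprSr mulrA; have /andP[] := step_bounds (cj0 j) h0.
Qed.

(** The two products differ only in their end factors, so their ratio is [exp (- lambda h (r - r'))]
    with rates [r], [r'] in [[0, 1]], whatever [M] is. *)
Lemma step_prod_gap p h M : 0 <= p -> 0 <= h ->
  step_prod p h M 1 * expR (- (lambda * h)) <= step_prod p h M 0.
Proof.
move=> p0 h0; have l0 : 0 <= lambda by rewrite lambdaE mulr_ge0// ltW.
set E := expR (- (k * h)).
have cj0 j : 0 <= p * E ^+ j by rewrite mulr_ge0 ?exprn_ge0 ?expR_ge0.
have -> : step_prod p h M 0 = step_prod p h M 1 *
    expR (- (lambda * h * (step_rate p - step_rate (p * E ^+ M)))).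
  rewrite /step_prod -/E; elim: M => [|M IH].
    by rewrite !big_ord0 expr0 mulr1 subrr mulr0 oppr0 expR0 mulr1.
  rewrite !big_ord_recr/= IH addn0 addn1 -!mulrA -!expRD; congr (_ * expR _).
  by ring.
apply: ler_wpM2l; first by have /andP[] := step_prod_ge0_le1 M 1 p0 h0.
rewrite ler_expR lerN2 -[leRHS]mulr1 ler_wpM2l ?mulr_ge0//.
have /andP[_ a1] := step_rate_ge0_le1 p0.
by have /andP[a0 _] := step_rate_ge0_le1 (cj0 M); lra.
Qed.

(** The one-step bounds are iterated: a jump in cell [i] decays over at most [M - i] and at least
    [M - i - 1] steps, as if it sat at the left or right end of its cell. *)
Lemma OU_grid_bounds (x0 : R) (x z : R -> R) (a h : R) (M : nat) :
  (forall t, 0 <= t -> lebesgue_measure.-integrable `[0, t] (fun s => (x s)%:E) /\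
     x t = x0 - k * \int[lebesgue_measure]_(s in `[0, t]) x s + z t) ->
  (forall s t, 0 <= s -> s <= t -> z s <= z t) -> 0 <= a -> 0 <= h ->
  \sum_(i < M) expR (- (k * h)) ^+ (M - i) *
      (z (a + h * i.+1%:R) - z (a + h * i%:R)) <=
    x (a + h * M%:R) - expR (- (k * h)) ^+ M * x a <=
  \sum_(i < M) expR (- (k * h)) ^+ (M - i).-1 *
      (z (a + h * i.+1%:R) - z (a + h * i%:R)).
Proof.
move=> xE zinc a0 h0; set E := expR _.
elim: M => [|M /andP[IH1 IH2]].
  by rewrite !big_ord0 mulr0 addr0 expr0 mul1r subrr lexx.
have E0 : 0 <= E := expR_ge0 _.
have uM : 0 <= a + h * M%:R by rewrite addr_ge0// mulr_ge0.
have uMS : a + h * M%:R <= a + h * M.+1%:R by rewrite lerD2l ler_wpM2l// ler_nat.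
have := OU_path_bounds k0 xE zinc uM uMS.
have -> : a + h * M.+1%:R - (a + h * M%:R) = h by rewrite -natr1; ring.
rewrite -/E => /andP[B1 B2].
rewrite !big_ord_recr/= subSnn expr1 expr0 mul1r.
have -> : \sum_(i < M) E ^+ (M.+1 - i) * (z (a + h * i.+1%:R) - z (a + h * i%:R)) =
    E * \sum_(i < M) E ^+ (M - i) * (z (a + h * i.+1%:R) - z (a + h * i%:R)).
  rewrite mulr_sumr; apply: eq_bigr => i _.
  by rewrite mulrA subSn 1?ltnW// exprS.
have -> : \sum_(i < M) E ^+ (M.+1 - i).-1 * (z (a + h * i.+1%:R) - z (a + h * i%:R)) =
    E * \sum_(i < M) E ^+ (M - i).-1 * (z (a + h * i.+1%:R) - z (a + h * i%:R)).
  rewrite mulr_sumr; apply: eq_bigr => i _.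
  by rewrite mulrA subSn 1?ltnW//= -exprS prednK// subn_gt0.
have := ler_wpM2l E0 IH1; have := ler_wpM2l E0 IH2; rewrite mulrBr mulrA -exprS.
by move=> C2 C1; apply/andP; split; lra.
Qed.

End grid_products.

(** * The joint Laplace transform of the two displacements *)

Section OU_laplace.
Context d (T : measurableType d) (R : realType) (P : probability T R).
Variables (k lambda beta x0 : R) (n : nat).
Hypotheses (k0 : 0 < k) (beta0 : 0 < beta) (lambdaE : lambda = k * n%:R).

Let lambda0 : 0 <= lambda.
Proof. by rewrite lambdaE mulr_ge0// ltW. Qed.

Section compound.
Variables (N : R -> {RV P >-> nat}) (J : nat -> {RV P >-> R}).
Hypothesis jd : jump_data lambda beta N J.
Local Notation Z := (compound N J).

(** In use [a1 = h1 * M = s] and [h2 * M = t]. Separate steps make [s] a grid point without any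
    rationality condition on [s / t]. *)
Definition two_segment_sum (a1 h1 h2 : R) (M : nat) (c1 c2 : nat -> R) (w : T) : R :=
  \sum_(i < M) c1 i * (Z (h1 * i.+1%:R) w - Z (h1 * i%:R) w) +
  \sum_(i < M) c2 i * (Z (a1 + h2 * i.+1%:R) w - Z (a1 + h2 * i%:R) w).

Lemma two_segment_laplace (h1 h2 : R) (M : nat) (c1 c2 : nat -> R) :
  0 <= h1 -> 0 <= h2 -> (forall i, 0 <= c1 i) -> (forall i, 0 <= c2 i) ->
  (\int[P]_w (expR (- two_segment_sum (h1 * M%:R) h1 h2 M c1 c2 w))%:E =
   (\prod_(i < M) expR (- (lambda * h1 * step_rate beta (c1 i))) *
    \prod_(i < M) expR (- (lambda * h2 * step_rate beta (c2 i))))%:E)%E.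
Proof.
move=> h10 h20 c10 c20.
(* Gluing the two grids into one sequence gives joint independence of the increments of both
   segments. The two formulas agree at [i = M]. *)
pose u i := if (i <= M)%N then h1 * i%:R else h1 * M%:R + h2 * (i - M)%:R.
pose c i := if (i < M)%N then c1 i else c2 (i - M)%N.
have uM i : u (M + i)%N = h1 * M%:R + h2 * i%:R.
  rewrite /u addKn; case: i => [|i]; first by rewrite addn0 leqnn mulr0 addr0.
  by rewrite leqNgt -addSnnS leq_addr.
have u_inc i : u i <= u i.+1.
  have [iM|Mi] := ltnP i M.
    by rewrite /u iM (ltnW iM) ler_wpM2l// ler_nat.
  by rewrite -(subnKC Mi) -addnS !uM lerD2l ler_wpM2l// ler_nat.
have u00 : 0 <= u 0%N by rewrite /u mulr0.
have c0 i : 0 <= c i by rewrite /c; case: ifP.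
have usub (i : 'I_M) : (u i = h1 * i%:R) * (u i.+1 = h1 * i.+1%:R) * (c i = c1 i).
  by rewrite /u /c ltn_ord (ltnW (ltn_ord i)).
have usub2 (i : 'I_M) : (u (M + i)%N = h1 * M%:R + h2 * i%:R) *
    (u (M + i).+1 = h1 * M%:R + h2 * i.+1%:R) * (c (M + i)%N = c2 i).
  by rewrite -addnS !uM /c ltnNge leq_addr/= addKn.
have sumE w : two_segment_sum (h1 * M%:R) h1 h2 M c1 c2 w =
    \sum_(i < M + M) c i * (Z (u i.+1) w - Z (u i) w).
  rewrite big_split_ord /two_segment_sum; congr (_ + _); apply: eq_bigr => i _.
    by have [[E1 E2] E3] := usub i; rewrite [u (lshift _ _)]E1 [c (lshift _ _)]E3 E2.
  have [[E1 E2] E3] := usub2 i.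
  by rewrite [u (rshift _ _)]E1 [c (rshift _ _)]E3 [u (rshift _ _).+1]E2.
under eq_integral do rewrite sumE.
rewrite (compound_laplace lambda0 beta0 jd (M + M) u00 u_inc c0); congr EFin.
have diffE (a b : R) i : a + b * i.+1%:R - (a + b * i%:R) = b.
  by rewrite -natr1; ring.
have diffE0 (b : R) i : b * i.+1%:R - b * i%:R = b by rewrite -natr1; ring.
rewrite big_split_ord; congr (_ * _); apply: eq_bigr => i _.
  have [[E1 E2] E3] := usub i.
  by rewrite [u (lshift _ _)]E1 [c (lshift _ _)]E3 E2 diffE0.
have [[E1 E2] E3] := usub2 i.
by rewrite [u (rshift _ _)]E1 [c (rshift _ _)]E3 [u (rshift _ _).+1]E2 diffE.
Qed.

Lemma compound_nondecreasing : {ae P, forall w, Z 0 w = 0 /\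
  forall s t, 0 <= s -> s <= t -> Z s w <= Z t w}.
Proof.
apply: filterS2 (poisson_paths (jump_count jd)) (jump_ge0 jd) => w [N0 Ninc _] J0.
split=> [|s t s0 st]; first by rewrite /compound N0 big_ord0.
rewrite /compound -!(big_mkord xpredT (fun i => J i w)).
rewrite (@big_cat_nat _ _ _ (N s w) 0 (N t w))//=; last exact: Ninc.
by rewrite lerDl sumr_ge0.
Qed.

End compound.

Lemma step_prodE c h M o (f : nat -> nat) :
  (forall i, (i < M)%N -> f i = (M - i.+1 + o)%N) ->
  \prod_(i < M) expR (- (lambda * h * step_rate beta (c * expR (- (k * h)) ^+ f i))) =
  step_prod k lambda beta c h M o.
Proof.
move=> fE; rewrite /step_prod [RHS](reindex_inj rev_ord_inj)/=.
by apply: eq_bigr => i _; rewrite fE.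
Qed.

Variables (X : R -> {RV P >-> R}).
Hypothesis hX : gamma_OU k lambda beta x0 X.

Definition laplace_factor (tau p : R) : R :=
  ((beta + p * expR (- (k * tau))) / (beta + p)) ^+ n.

(** Both the expectation and the product of factors lie between [prod 0] and [prod 1]. Multiplying
    the gaps of the two segments gives [prod 1 * exp (- C) <= prod 0]; as [exp (- C) >= 1 - C] and
    [prod 1 <= 1], the interval has length at most [C]. *)
Lemma OU_laplace_gap (s t p q : R) (M : nat) :
  0 <= s -> 0 <= t -> 0 <= p -> 0 <= q -> (0 < M)%N ->
  ((laplace_factor s p * laplace_factor t q - lambda * (s + t) / M%:R)%:E <=
   \int[P]_w (expR (- (p * (X s w - expR (- (k * s)) * x0) +
     q * (X (t + s) w - expR (- (k * t)) * X s w))))%:E <=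
   (laplace_factor s p * laplace_factor t q + lambda * (s + t) / M%:R)%:E)%E.
Proof.
move=> s0 t0 p0 q0 M0.
set G := _ * laplace_factor t q; set C := _ / M%:R.
have [N [J [jd sol]]] := hX.
have M0' : 0 < M%:R :> R by rewrite ltr0n.
pose h1 := s / M%:R; pose h2 := t / M%:R.
have h10 : 0 <= h1 by rewrite divr_ge0.
have h20 : 0 <= h2 by rewrite divr_ge0.
have h1M : h1 * M%:R = s by rewrite divfK// gt_eqF.
have h2M : h2 * M%:R = t by rewrite divfK// gt_eqF.
pose E1 := expR (- (k * h1)); pose E2 := expR (- (k * h2)).
have E1M : E1 ^+ M = expR (- (k * s)) by rewrite -expRM_natl -h1M; congr expR; ring.
have E2M : E2 ^+ M = expR (- (k * t)) by rewrite -expRM_natl -h2M; congr expR; ring.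
pose V w := p * (X s w - expR (- (k * s)) * x0) +
     q * (X (t + s) w - expR (- (k * t)) * X s w).
pose S := two_segment_sum N J (h1 * M%:R) h1 h2 M.
pose lo := S (fun i => p * E1 ^+ (M - i)) (fun i => q * E2 ^+ (M - i)).
pose hi := S (fun i => p * E1 ^+ (M - i).-1) (fun i => q * E2 ^+ (M - i).-1).
have bounds : {ae P, forall w, lo w <= V w <= hi w}.
  apply: filterS2 sol (compound_nondecreasing jd) => w xE [z0 zinc].
  have X0 : X 0 w = x0.
    by have [_ ->] := xE 0 (lexx 0); rewrite set_itv1 Rintegral_set1 z0; ring.
  have /andP[B1 B2] := OU_grid_bounds k0 M xE zinc (lexx 0) h10.
  have /andP[B3 B4] := OU_grid_bounds k0 M xE zinc s0 h20.
  move: B1 B2 B3 B4; rewrite -/E1 -/E2 E1M E2M h1M h2M X0 add0r [s + t]addrC.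
  under eq_bigr do rewrite !add0r.
  move=> B1; under eq_bigr do rewrite !add0r.
  move=> B2 B3 B4; rewrite /lo /hi /S /two_segment_sum /V h1M.
  by apply/andP; split; apply: lerD; under eq_bigr do rewrite -mulrA;
    rewrite -mulr_sumr; apply: ler_wpM2l.
have mS c1 c2 : measurable_fun setT (S c1 c2).
  have mZ i j : measurable_fun setT (fun w => compound N J i w - compound N J j w).
    by apply: measurable_funB; exact: measurable_compound.
  by apply: measurable_funD; apply: measurable_sum => i; apply: measurable_funM.
have mV : measurable_fun setT V.
  by apply: measurable_funD; apply: measurable_funM => //; apply: measurable_funB => //;
    exact: measurable_funM.
have mexp (f : T -> R) : measurable_fun setT f ->
    measurable_fun setT (fun w => (expR (- f w))%:E).
  move=> mf; apply/measurable_EFinP; apply: measurableT_comp => //.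
  exact: measurableT_comp.
have le_exp (f g : T -> R) : measurable_fun setT f -> measurable_fun setT g ->
    {ae P, forall w, f w <= g w} ->
    (\int[P]_w (expR (- g w))%:E <= \int[P]_w (expR (- f w))%:E)%E.
  move=> mf mg fg; apply: ae_ge0_le_integral => //.
  - exact: mexp.
  - exact: mexp.
  - by apply: filterS fg => w fg _; rewrite lee_fin ler_expR lerN2.
have E1_0 i : 0 <= E1 ^+ i by rewrite exprn_ge0 ?expR_ge0.
have E2_0 i : 0 <= E2 ^+ i by rewrite exprn_ge0 ?expR_ge0.
pose prod o := step_prod k lambda beta p h1 M o * step_prod k lambda beta q h2 M o.
have Ehi : (\int[P]_w (expR (- hi w))%:E = (prod 0%N)%:E)%E.
  rewrite (two_segment_laplace jd)//; last 2 first.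
  - by move=> i; rewrite mulr_ge0.
  - by move=> i; rewrite mulr_ge0.
  by congr EFin; congr (_ * _);
    [apply: (@step_prodE p h1 M 0 (fun i => (M - i).-1)%N)
    |apply: (@step_prodE q h2 M 0 (fun i => (M - i).-1)%N)] => i iM; rewrite addn0 subnS.
have Elo : (\int[P]_w (expR (- lo w))%:E = (prod 1%N)%:E)%E.
  rewrite (two_segment_laplace jd)//; last 2 first.
  - by move=> i; rewrite mulr_ge0.
  - by move=> i; rewrite mulr_ge0.
  by congr EFin; congr (_ * _);
    [apply: (@step_prodE p h1 M 1 (fun i => M - i)%N)
    |apply: (@step_prodE q h2 M 1 (fun i => M - i)%N)] => i iM; rewrite addn1 subnSK.
have le1 : ((prod 0%N)%:E <= \int[P]_w (expR (- V w))%:E)%E.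
  by rewrite -Ehi; apply: (le_exp V hi mV (mS _ _)); apply: filterS bounds => w /andP[].
have le2 : (\int[P]_w (expR (- V w))%:E <= (prod 1%N)%:E)%E.
  by rewrite -Elo; apply: (le_exp lo V (mS _ _) mV); apply: filterS bounds => w /andP[].
have /andP[a0 a1] := step_prod_bounds beta0 lambdaE M p0 h10.
have /andP[b0 b1] := step_prod_bounds beta0 lambdaE M q0 h20.
have a01 o := step_prod_ge0_le1 k0 beta0 lambdaE M o p0 h10.
have b01 o := step_prod_ge0_le1 k0 beta0 lambdaE M o q0 h20.
have G0 : prod 0%N <= G.
  rewrite /G /laplace_factor -h1M -h2M; apply: ler_pM => //.
    by have /andP[] := a01 0%N.
  by have /andP[] := b01 0%N.
have G1 : G <= prod 1%N.
  rewrite /G /laplace_factor -h1M -h2M; apply: ler_pM => //.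
    by apply: (le_trans _ a0); have /andP[] := a01 0%N.
  by apply: (le_trans _ b0); have /andP[] := b01 0%N.
have gap : prod 1%N - C <= prod 0%N.
  have ga := step_prod_gap k0 beta0 lambdaE M p0 h10.
  have gb := step_prod_gap k0 beta0 lambdaE M q0 h20.
  have /andP[x0' x1] := a01 1%N; have /andP[y0 y1] := b01 1%N.
  have := ler_pM (mulr_ge0 x0' (expR_ge0 _)) (mulr_ge0 y0 (expR_ge0 _)) ga gb.
  rewrite mulrACA -expRD -opprD => /(le_trans _); apply.
  have CE : lambda * h1 + lambda * h2 = C by rewrite /C /h1 /h2; ring.
  have xy1 : prod 1%N <= 1 by rewrite /prod mulr_ile1.
  rewrite -/(prod 1%N) CE.
  have := ler_wpM2l (mulr_ge0 x0' y0) (expR_ge1Dx (- C)); apply: le_trans.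
  have C0 : 0 <= C by rewrite /C divr_ge0 ?mulr_ge0 ?addr_ge0 ?(ltW M0').
  by have := ler_wpM2r C0 xy1; rewrite -/(prod 1%N); lra.
apply/andP; split.
  by apply: le_trans le1; rewrite lee_fin; lra.
by apply: le_trans le2 _; rewrite lee_fin; lra.
Qed.

Theorem OU_laplace (s t p q : R) : 0 <= s -> 0 <= t -> 0 <= p -> 0 <= q ->
  (\int[P]_w (expR (- (p * (X s w - expR (- (k * s)) * x0) +
     q * (X (t + s) w - expR (- (k * t)) * X s w))))%:E =
   (laplace_factor s p * laplace_factor t q)%:E)%E.
Proof.
move=> s0 t0 p0 q0; set E := integral _ _ _; set G := _ * laplace_factor t q.
pose C := lambda * (s + t).
have gap M : (0 < M)%N -> ((G - C / M%:R)%:E <= E <= (G + C / M%:R)%:E)%E.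
  by move=> M0; exact: OU_laplace_gap.
have cC : C * harmonic n @[n --> \oo] --> 0.
  by rewrite -[X in _ --> X](mulr0 C); apply: cvgMl_tmp; exact: cvg_harmonic.
have up : (G + C * harmonic n)%:E @[n --> \oo] --> G%:E.
  apply: cvg_EFin; first exact: nearW.
  by rewrite -[X in _ --> X]addr0; apply: cvgD => //; exact: cvg_cst.
have lo : (G - C * harmonic n)%:E @[n --> \oo] --> G%:E.
  apply: cvg_EFin; first exact: nearW.
  by rewrite -[X in _ --> X]subr0; apply: cvgB => //; exact: cvg_cst.
apply/eqP; rewrite eq_le; apply/andP; split.
- apply: (cvge_ge _ up); apply: nearW => m.
  by have /andP[_] := gap m.+1 isT.
- apply: (cvge_le _ lo); apply: nearW => m.
  by have /andP[] := gap m.+1 isT.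
Qed.

End OU_laplace.

(** * The limiting mixture *)

Section atom_density.
Local Open Scope ereal_scope.
Context (R : realType) (c : R) (f : R -> R).
Local Notation mu := (@lebesgue_measure R).

(** The proofs are arguments so that the probability structure can be attached to the resulting
    term. *)
Definition atom_density (c0 : (0 <= c)%R) (f0 : forall x, (0 <= f x)%R)
    (mf : measurable_fun setT f)
    (total : c%:E + \int[mu]_x (f x)%:E = 1) (A : set R) : \bar R :=
  c%:E * \d_(0%R : R) A + \int[mu]_(x in A) (f x)%:E.

Hypotheses (c0 : (0 <= c)%R) (f0 : forall x, (0 <= f x)%R).
Hypothesis mf : measurable_fun setT f.
Hypothesis total : c%:E + \int[mu]_x (f x)%:E = 1.
Local Notation nu := (atom_density c0 f0 mf total).

Let nu0 : nu set0 = 0.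
Proof. by rewrite /atom_density measure0 integral_set0 mule0 adde0. Qed.

Let nu_ge0 A : 0 <= nu A.
Proof.
by rewrite adde_ge0 ?mule_ge0 ?lee_fin//; apply: integral_ge0 => x _; rewrite lee_fin.
Qed.

Let nu_sigma_additive : semi_sigma_additive nu.
Proof.
move=> F mF tF mUF; rewrite /atom_density ge0_integral_bigcup//; last 2 first.
- by apply/measurable_EFinP; exact: measurable_funTS.
- by move=> x _; rewrite lee_fin.
rewrite (measure_semi_bigcup _ mF tF mUF) -nneseriesZl//.
rewrite -nneseriesD//; last 2 first.
- by move=> i *; rewrite mule_ge0 ?lee_fin.
- by move=> i *; apply: integral_ge0 => x _; rewrite lee_fin.
apply: cvg_toP => //; apply: is_cvg_nneseries => i *.
by rewrite adde_ge0 ?mule_ge0 ?lee_fin//; apply: integral_ge0 => x _; rewrite lee_fin.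
Qed.

HB.instance Definition _ := isMeasure.Build _ _ _ nu nu0 nu_ge0 nu_sigma_additive.

Let nu_setT : nu setT = 1.
Proof. by rewrite /atom_density diracT mule1. Qed.

HB.instance Definition _ := @Measure_isProbability.Build _ _ R nu nu_setT.

End atom_density.

Section tail_uniqueness.
Context (R : realType).

(** Laplace inversion yields tails at [y >= 0] only. Without mass on the negative half-line, the
    tails at [y < 0] have the total mass, and open upper half-lines form a generating system closed
    under intersection. *)
Lemma tail_unique (m1 m2 : {measure set R -> \bar R}) :
  (m1 setT < +oo)%E -> m1 setT = m2 setT ->
  m1 `]-oo, 0[%classic = 0%E -> m2 `]-oo, 0[%classic = 0%E ->
  (forall y, 0 <= y -> m1 `]y, +oo[%classic = m2 `]y, +oo[%classic) ->
  forall A, measurable A -> m1 A = m2 A.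
Proof.
move=> fin1 total neg1 neg2 tails A mA.
have all_tails y : m1 `]y, +oo[%classic = m2 `]y, +oo[%classic.
  have [/tails //|y0] := leP 0 y.
  have tail_total (m : {measure set R -> \bar R}) : m `]-oo, 0[%classic = 0%E ->
      m `]y, +oo[%classic = m setT.
    move=> m0; apply/eqP; rewrite eq_le; apply/andP; split.
      by apply: le_measure; rewrite ?inE.
    apply: (@le_trans _ _ (m (`]y, +oo[%classic `|` `]-oo, 0[%classic))).
      apply: le_measure; rewrite ?inE//; first exact: measurableU.
      move=> x _ /=; rewrite !in_itv/= andbT.
      by have [?|?] := ltP x 0; [right|left; exact: lt_le_trans y0 _].
    apply: (@le_trans _ _ (m `]y, +oo[%classic + m `]-oo, 0%R[%classic)%E).
      exact: measureU2.
    by rewrite m0 adde0.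
  by rewrite !tail_total.
apply: (measure_unique (@RGenOInfty.G R) (fun n => `](- n%:R), +oo[%classic)) => //.
- exact: RGenOInfty.measurableE.
- move=> _ _ [x ->] [y ->]; exists (Num.max x y).
  by apply/seteqP; split => z /=; rewrite !in_itv/= !andbT gt_max => /andP.
- by move=> n; exists (- n%:R).
- apply/seteqP; split => // x _; exists (Num.truncn `|x|).+1 => //=.
  rewrite in_itv/= andbT ltrNl (le_lt_trans (ler_norm _))// normrN.
  by have /andP[] := truncn_itv (normr_ge0 x).
- by move=> _ [y ->]; exact: all_tails.
- move=> n; apply: le_lt_trans fin1; apply: le_measure; rewrite ?inE//.
Qed.

End tail_uniqueness.

Section mixture.
Context (R : realType) (a beta : R) (n : nat).
Hypotheses (a0 : 0 <= a) (a1 : a <= 1) (beta0 : 0 < beta).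
Local Notation mu := (@lebesgue_measure R).
Local Notation g := (gd_reg (g_density a n beta)).

Let weight j : R := 'C(n, j)%:R * a ^+ (n - j) * (1 - a) ^+ j.

Let weight_ge0 j : 0 <= weight j.
Proof. by rewrite !mulr_ge0 ?exprn_ge0// subr_ge0. Qed.

Let gE : g = fun x => \sum_(0 <= j < n) weight j.+1 * erlang_pdf j.+1 beta x.
Proof. by apply/funext => x; rewrite /= big_add1. Qed.

Lemma g_density_ge0 x : 0 <= g x.
Proof.
rewrite gE; apply: sumr_ge0 => j _.
by rewrite mulr_ge0// erlang_pdf_ge0// ltW.
Qed.

Lemma measurable_g_density : measurable_fun setT g.
Proof.
rewrite gE; apply: measurable_sum => j; apply: measurable_funM => //.
exact: measurable_erlang_pdf.
Qed.

Lemma laplace_g_density th : 0 <= th ->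
  ((a ^+ n)%:E + \int[mu]_x (g x * expR (- (th * x)))%:E =
   (((beta + th * a) / (beta + th)) ^+ n)%:E)%E.
Proof.
move=> th0; have bt : 0 < beta + th by rewrite ltr_pwDl.
have mexp : measurable_fun setT (fun x : R => expR (- (th * x))).
  by apply: measurableT_comp => //; apply: measurableT_comp.
have mterm j : measurable_fun setT (fun x => erlang_pdf j.+1 beta x * expR (- (th * x))).
  by apply: measurable_funM => //; exact: measurable_erlang_pdf.
have term0 j x : 0 <= erlang_pdf j.+1 beta x * expR (- (th * x)).
  by rewrite mulr_ge0 ?expR_ge0// erlang_pdf_ge0// ltW.
have -> : (\int[mu]_x (g x * expR (- (th * x)))%:E =
    \int[mu]_x \sum_(0 <= j < n)
      ((weight j.+1)%:E * (erlang_pdf j.+1 beta x * expR (- (th * x)))%:E))%E.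
  apply: eq_integral => x _; rewrite gE mulr_suml -sumEFin.
  by apply: eq_bigr => j _; rewrite -EFinM mulrA.
rewrite ge0_integral_sum//; last 2 first.
- by move=> j; apply: emeasurable_funM => //; apply/measurable_EFinP; exact: mterm.
- by move=> j x _; rewrite -EFinM lee_fin mulr_ge0.
under eq_bigr => j _.
  rewrite ge0_integralZl_EFin//; last 2 first.
  - by move=> x _; rewrite lee_fin.
  - by apply/measurable_EFinP; exact: mterm.
  rewrite laplace_erlang// -EFinM; over.
rewrite sumEFin -EFinD; congr EFin.
(* The base is the transform of an atom at 0 of mass [a] mixed with an exponential law of mass
   [1 - a]; in the expansion of its power, [j = 0] is the atom [a ^+ n]. *)
have -> : (beta + th * a) / (beta + th) = a + (1 - a) * (beta / (beta + th)).
  by field; rewrite gt_eqF.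
rewrite exprDn -(big_mkord xpredT
  (fun i => (a ^+ (n - i) * ((1 - a) * (beta / (beta + th))) ^+ i) *+ 'C(n, i))).
rewrite big_nat_recl// subn0 expr0 mulr1 bin0 mulr1n; congr (_ + _).
by apply: eq_bigr => j _; rewrite /weight [in RHS]exprMn -[RHS]mulr_natl; ring.
Qed.

Lemma g_density_total : ((a ^+ n)%:E + \int[mu]_x (g x)%:E = 1)%E.
Proof.
have := laplace_g_density (lexx 0).
rewrite mul0r !addr0 divff ?gt_eqF// expr1n => <-; congr (_ + _)%E.
by apply: eq_integral => x _; rewrite mul0r oppr0 expR0 mulr1.
Qed.

Definition mixture : probability R R :=
  atom_density (exprn_ge0 n a0) g_density_ge0 measurable_g_density g_density_total.

Lemma mixtureE A :
  (mixture A = (a ^+ n)%:E * \d_(0%R : R) A + \int[mu]_(x in A) (g x)%:E)%E.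
Proof. by []. Qed.

End mixture.

(** * The translated mixture as a probability kernel *)

Section shift_kernel.
Context (R : realType) (nu : probability R R) (a : R).

Let measurable_shift y : measurable_fun setT (fun x : R => x + a * y).
Proof. exact: measurable_funD. Qed.

Let shift (y : R) : {mfun R >-> R} :=
  HB.pack (fun x : R => x + a * y) (isMeasurableFun.Build _ _ _ _ _ (measurable_shift y)).

Definition shift_kernel (y : R) : {measure set R -> \bar R} :=
  distribution nu (shift y).

Lemma shift_kernelE y A : shift_kernel y A = nu [set x | A (x + a * y)].
Proof. by []. Qed.

Let measurable_shift_kernel A : measurable A ->
  measurable_fun setT (shift_kernel ^~ A).
Proof.
move=> mA; pose D := [set p : R * R | A (p.2 + a * p.1)].
have mD : measurable D.
  have mf : measurable_fun setT (fun p : R * R => p.2 + a * p.1).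
    by apply: measurable_funD => //; apply: measurable_funM.
  by rewrite -[D]setTI; exact: mf.
have := measurable_fun_xsection nu mD.
by apply: eq_measurable_fun => y _; rewrite /= /xsection; congr (nu _);
  apply/seteqP; split => x /=; rewrite inE.
Qed.

HB.instance Definition _ :=
  isKernel.Build _ _ R R R shift_kernel measurable_shift_kernel.

Let shift_kernel_setT y : shift_kernel y setT = 1%E.
Proof. by rewrite shift_kernelE -[RHS](@probability_setT _ _ _ nu). Qed.

HB.instance Definition _ :=
  Kernel_isProbability.Build _ _ R R R shift_kernel shift_kernel_setT.

End shift_kernel.

Section lebesgue_shift.
Context (R : realType).
Local Notation mu := (@lebesgue_measure R).

Lemma lebesgue_measure_shift (c : R) (A : set R) : measurable A ->
  mu A = pushforward mu ((fun x => x + c) : _ -> measurableTypeR R) A.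
Proof.
move=> mA; apply: lebesgue_measure_unique => //=.
  exact: measurable_funD.
move=> mf _ [[u v] _ <-].
rewrite /pushforward (_ : _ @^-1` _ = `]u - c, v - c]%classic).
  rewrite !lebesgue_measure_itv/= !lte_fin ltrD2r.
  by case: ifP => // _; rewrite -!EFinB; congr EFin; ring.
by apply/seteqP; split => x /=; rewrite !in_itv/= ltrBlDr lerBrDr.
Qed.

Lemma ge0_integral_shift (c : R) (f : R -> R) (A : set R) :
  measurable_fun setT f -> (forall x, 0 <= f x) -> measurable A ->
  (\int[mu]_(x in [set x | A (x + c)%R]) (f x)%:E =
   \int[mu]_(x in A) (f (x - c)%R)%:E)%E.
Proof.
move=> mf f0 mA.
have mshift : measurable_fun setT ((fun x => x + c) : R -> measurableTypeR R).
  exact: measurable_funD.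
have mfc : measurable_fun setT (fun x : R => f (x - c)).
  by apply: measurableT_comp => //; exact: measurable_funB.
transitivity (\int[pushforward mu ((fun x => (x + c)%R) : R -> measurableTypeR R)]_(x in A)
    (f (x - c)%R)%:E)%E.
  rewrite ge0_integral_pushforward//.
  - by apply: eq_integral => x _ /=; rewrite addrK.
  - by apply: measurable_funTS; apply/measurable_EFinP.
  - by move=> x _; rewrite lee_fin.
apply/esym; apply: eq_measure_integral => //= B mB _.
exact: lebesgue_measure_shift.
Qed.

End lebesgue_shift.

Lemma shift_kernel_gen_density (R : realType) (a beta : R) (n : nat) (y : R)
    (a0 : 0 <= a) (a1 : a <= 1) (beta0 : 0 < beta) :
  has_gen_density (shift_kernel (mixture n a0 a1 beta0) a y)
    (gd_shift (a * y) (g_density a n beta)).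
Proof.
have mg := @measurable_g_density R a beta n.
split=> [|A mA].
  by apply: (measurableT_comp mg); exact: measurable_funB.
rewrite shift_kernelE mixtureE /gd_shift; congr (_ * _ + _)%E.
by rewrite ge0_integral_shift// => x; exact: g_density_ge0.
Qed.

(** * Identification of the conditional law *)

(* [pushforward] carries its measure structure only relative to a measurability
   proof, which is not inferred; here that proof is an argument. *)
Definition image_measure d (T : measurableType d) d' (T' : measurableType d')
    (R : realType) (mu : {measure set T -> \bar R}) (V : T -> T')
    (mV : measurable_fun setT V) : {measure set T' -> \bar R} :=
  measure_function_pushforward__canonical__measure_function_Measure mu mV.

Section laplace_independence.
Local Open Scope ereal_scope.
Context (R : realType).

(** [V2] need only be nonnegative up to a null set, so that it can be the identity under the
    mixture. *)
Lemma tail_law_unique d1 (T1 : measurableType d1) d2 (T2 : measurableType d2)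
    (mu1 : {measure set T1 -> \bar R}) (mu2 : {measure set T2 -> \bar R})
    (V1 : T1 -> R) (V2 : T2 -> R) :
  measurable_fun setT V1 -> measurable_fun setT V2 ->
  (forall x, 0 <= V1 x)%R -> (mu2 [set x | V2 x < 0]%R = 0) ->
  mu1 setT < +oo -> mu1 setT = mu2 setT ->
  (forall y, (0 <= y)%R -> mu1 [set x | y < V1 x]%R = mu2 [set x | y < V2 x]%R) ->
  forall A, measurable A -> mu1 (V1 @^-1` A) = mu2 (V2 @^-1` A).
Proof.
move=> mV1 mV2 V10 V20 fin1 total tails A mA.
have tailE (T : Type) (V : T -> R) y : V @^-1` `]y, +oo[ = [set x | y < V x]%R.
  by apply/seteqP; split => x; rewrite /= in_itv/= andbT.
have negE (T : Type) (V : T -> R) : V @^-1` `]-oo, 0%R[ = [set x | V x < 0]%R.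
  by apply/seteqP; split => x; rewrite /= in_itv.
apply: (@tail_unique R (image_measure mu1 mV1) (image_measure mu2 mV2)) => //=.
- rewrite /pushforward negE (_ : [set x | _] = set0) ?measure0//.
  by apply/seteqP; split => // x /=; rewrite ltNge V10.
- by move=> y y0; rewrite /pushforward !tailE tails.
Qed.

Context d (T : measurableType d) (P : probability T R).

Lemma measurable_tail (V : T -> R) y : measurable_fun setT V ->
  measurable [set x | y < V x]%R.
Proof.
move=> mV; rewrite (_ : [set _ | _] = setT `&` V @^-1` `]y, +oo[); first exact: mV.
by rewrite setTI; apply/seteqP; split => x; rewrite /= in_itv/= andbT.
Qed.

Variables (U W : T -> R) (f : R -> R) (c : R).
Hypotheses (mU : measurable_fun setT U) (mW : measurable_fun setT W).
Hypotheses (U0 : forall w, (0 <= U w)%R) (W0 : forall w, (0 <= W w)%R).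
Hypotheses (c0 : (0 <= c)%R) (f0 : forall x, (0 <= f x)%R).
Hypotheses (mf : measurable_fun setT f).
Hypothesis total : c%:E + \int[lebesgue_measure]_x (f x)%:E = 1.
Hypothesis f_neg : forall x, (x < 0)%R -> f x = 0%R.
Hypothesis laplaceE : forall i j : nat,
  \int[P]_w (expR (- W w) ^+ j * expR (- U w) ^+ i)%:E =
  \int[P]_w (expR (- U w) ^+ i)%:E *
  (c%:E + \int[lebesgue_measure]_x (f x * expR (- (j%:R * x)))%:E).

Let nu : probability R R := atom_density c0 f0 mf total.

Let L j := fine (c%:E + \int[lebesgue_measure]_x (f x * expR (- (j%:R * x)))%:E).

Let exp01 (x : R) j : (0 <= x)%R -> (0 <= expR (- x) ^+ j <= 1)%R.
Proof.
move=> x0; rewrite exprn_ge0 ?expR_ge0//= exprn_ile1 ?expR_ge0//.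
by rewrite -[leRHS]expR0 ler_expR oppr_le0.
Qed.

Let mexp (V : T -> R) j : measurable_fun setT V ->
  measurable_fun setT (fun w : T => expR (- V w) ^+ j)%R.
Proof.
by move=> mV; apply: measurable_funX; apply: measurableT_comp => //; exact: measurableT_comp.
Qed.

Let LE j : c%:E + \int[lebesgue_measure]_x (f x * expR (- (j%:R * x)))%:E = (L j)%:E.
Proof.
have int0 : 0 <= \int[lebesgue_measure]_x (f x * expR (- (j%:R * x)))%:E.
  by apply: integral_ge0 => x _; rewrite lee_fin mulr_ge0 ?expR_ge0.
rewrite /L fineK// ge0_fin_numE; last by rewrite adde_ge0// lee_fin.
apply: (@le_lt_trans _ _ 1); last exact: ltry.
rewrite -total leeD2l//; apply: ge0_le_integral => //.
- by move=> x _; rewrite lee_fin mulr_ge0 ?expR_ge0.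
- apply/measurable_EFinP; apply: measurable_funM => //.
  by apply: measurableT_comp => //; apply: measurableT_comp.
- by apply/measurable_EFinP.
- move=> x _; rewrite lee_fin; have [x0|x0] := ltP x 0%R.
    by rewrite f_neg// mul0r.
  by rewrite ler_piMr// -[leRHS]expR0 ler_expR oppr_le0 mulr_ge0.
Qed.

Let int1 j (V : T -> R) : measurable_fun setT V -> (forall w, 0 <= V w)%R ->
  P.-integrable setT (fun w => (expR (- V w) ^+ j)%:E).
Proof.
move=> mV V0; apply: (@le_integrable _ _ _ P setT measurableT _ (fun=> 1)).
- by apply/measurable_EFinP; exact: mexp.
- by move=> w _; have /andP[e0 e1] := exp01 j (V0 w); rewrite /= lee_fin normr1 ger0_norm.
- exact: finite_measure_integrable_cst.
Qed.

(** Inversion in [U]: for fixed [j], the weight [exp (- j W)] and the constant [L j] give the same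
    transform of [U]. *)
Let weighted_tail y j : (0 <= y)%R ->
  \int[P]_(w in [set w | y < U w]%R) (expR (- W w) ^+ j)%:E =
  (L j)%:E * P [set w | y < U w]%R.
Proof.
move=> y0; rewrite -integral_cst; last exact: measurable_tail.
apply: (@laplace_tail _ _ _ _ _ _ _ (fun w => expR (- W w) ^+ j)%R U (fun=> L j) U 0) => //.
- exact: int1.
- exact: finite_measure_integrable_cst.
- move=> i; rewrite add0e laplaceE LE muleC; under [RHS]eq_integral do rewrite EFinM.
  by rewrite integralZl//; exact: int1.
Qed.

Let weighted_setT j :
  \int[P]_(w in setT) (expR (- W w) ^+ j)%:E = (L j)%:E * P setT.
Proof.
have := laplaceE 0 j; rewrite LE muleC.
rewrite (_ : \int[P]_w (expR (- U w) ^+ 0)%:E = P setT); last first.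
  by rewrite -[RHS]mul1e -integral_cst.
by move=> <-; apply: eq_integral => w _; rewrite expr0 mulr1.
Qed.

(** Inversion in [W] with weight [\1_A]. The atom enters [laplace_tail] as the constant [P A * c],
    the density as the weight [p * f]; [Num.max x 0] supplies a nonnegative variable and changes
    nothing, as [f] vanishes on negatives. *)
Let joint_tail A y' : measurable A ->
  (forall j, \int[P]_(w in A) (expR (- W w) ^+ j)%:E = (L j)%:E * P A) ->
  (0 <= y')%R ->
  P ([set w | y' < W w]%R `&` A) = P A * nu [set x | y' < x]%R.
Proof.
move=> mA wA y'0.
have mB : measurable [set w | y' < W w]%R by exact: measurable_tail.
pose p := fine (P A).
have pE : P A = p%:E by rewrite /p fineK// fin_num_measure.
have p0 : (0 <= p)%R by rewrite fine_ge0.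
have mmax : measurable_fun setT (fun x : R => Num.max x 0%R) by exact: measurable_maxr.
transitivity (\int[P]_(w in [set w | y' < W w]%R) (\1_A w)%:E).
  by rewrite integral_indic// setIC.
have maxE : [set x | y' < Num.max x 0]%R = [set x | y' < x]%R.
  apply/seteqP; split => x /=; rewrite lt_max; last by move=> ->.
  by case/orP => //; rewrite ltNge y'0.
have mexpmax j : measurable_fun setT (fun x : R => expR (- Num.max x 0) ^+ j)%R.
  by apply: measurable_funX; apply: measurableT_comp => //; exact: measurableT_comp.
have if_ : lebesgue_measure.-integrable setT (fun x => (f x)%:E).
  apply/integrableP; split; first exact/measurable_EFinP.
  under eq_integral do rewrite /= ger0_norm//.
  apply: (@le_lt_trans _ _ 1); last exact: ltry.
  by rewrite -total leeDr// lee_fin.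
have ipf : lebesgue_measure.-integrable setT (fun x => (p * f x)%:E).
  exact: (@integrableZl _ _ _ _ _ _ p) if_.
rewrite (@laplace_tail _ _ _ P _ _ lebesgue_measure (\1_A) W
  (fun x => p * f x)%R (fun x => Num.max x 0%R) (p * c)%R)//.
- rewrite maxE; under eq_integral do rewrite EFinM.
  rewrite ge0_integralZl_EFin//; last 3 first.
  + have := @measurable_itv R `]y', +oo[.
    by rewrite (_ : [set` _] = [set x | y' < x]%R)//;
      apply/seteqP; split => x; rewrite /= in_itv/= andbT.
  + by move=> x _; rewrite lee_fin.
  + by apply/measurable_EFinP; exact: measurable_funTS.
  rewrite pE /nu /= /atom_density diracE memNset ?mule0 ?add0e//.
  by rewrite /= ltNge y'0.
- exact: integrable_indic.
- by move=> x; rewrite le_max lexx orbT.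
- move=> j.
  transitivity (\int[P]_(w in A) (expR (- W w) ^+ j)%:E).
    rewrite [RHS]integral_mkcond; apply: eq_integral => w _.
    by rewrite patchE indicE; case: (w \in A); rewrite ?mul1r ?mul0r.
  rewrite wA pE -LE muleC muleDr//; congr (_ + _).
  rewrite -ge0_integralZl_EFin//.
  + apply: eq_integral => x _; rewrite -EFinM; congr EFin; rewrite -mulrA; congr (_ * _)%R.
    have [x0|x0] := ltP x 0%R; first by rewrite f_neg// !mul0r.
    by rewrite -expRM_natl mulrN.
  + by move=> x _; rewrite lee_fin mulr_ge0 ?expR_ge0.
  + apply/measurable_EFinP; apply: measurable_funM => //.
    by apply: measurableT_comp => //; apply: measurableT_comp.
Qed.

(** Tails are extended to Borel sets one coordinate at a time: [step1] does so in [W] for a fixed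
    event [E], and its instances for tails of [U] and for the whole space provide the tails and the
    total mass for the extension in [U]. *)
Lemma laplace_independent A B : measurable A -> measurable B ->
  P (U @^-1` A `&` W @^-1` B) = P (U @^-1` A) * nu B.
Proof.
move=> mA mB.
have mpre (V : T -> R) D : measurable_fun setT V -> measurable D -> measurable (V @^-1` D).
  by move=> mV mD; rewrite -[X in measurable X]setTI; exact: mV.
have nu_neg : nu [set x | x < 0]%R = 0.
  rewrite /nu /= /atom_density diracE memNset ?mule0 ?add0e//=; last by rewrite ltxx.
  by rewrite integral0_eq// => x /= x0; rewrite f_neg.
have P_neg (V : T -> R) : (forall w, 0 <= V w)%R -> P [set w | V w < 0]%R = 0.
  move=> V0; rewrite (_ : [set w | _] = set0) ?measure0//.
  by apply/seteqP; split => // x /=; rewrite ltNge V0.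
have nu1 : nu setT = 1 := probability_setT nu.
have step1 E D : measurable E -> measurable D ->
    (forall j, \int[P]_(w in E) (expR (- W w) ^+ j)%:E = (L j)%:E * P E) ->
    P (W @^-1` D `&` E) = P E * nu D.
  move=> mE mD wE.
  have pfin : P E \is a fin_num by exact: fin_num_measure.
  have p0 : (0 <= fine (P E))%R by rewrite fine_ge0.
  have := @tail_law_unique _ T _ R (mrestr P mE) (mscale (NngNum p0) nu) W id.
  rewrite /= /mrestr /mscale /= fineK// => H; apply: H => //.
  - by rewrite nu_neg mule0.
  - by rewrite setTI ltey_eq pfin.
  - by rewrite setTI nu1 mule1.
  - by move=> y' y'0; exact: joint_tail.
have nuB_fin : nu B \is a fin_num by exact: fin_num_measure.
have nuB0 : (0 <= fine (nu B))%R by rewrite fine_ge0.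
have := @tail_law_unique _ T _ T (mrestr P (mpre W B mW mB))
  (mscale (NngNum nuB0) P) U U.
rewrite /= /mrestr /mscale /= fineK// => H; rewrite muleC; apply: H => //.
- by rewrite P_neg// mule0.
- by rewrite setTI (le_lt_trans (probability_le1 _ _)) ?ltry//; exact: mpre.
- by rewrite setTI -[W @^-1` B]setIT step1// muleC.
- move=> y y0; rewrite setIC step1//; first exact: muleC.
    exact: measurable_tail.
  by move=> j; exact: weighted_tail.
Qed.

End laplace_independence.

Section conditional_law_shift.
Context d (T : measurableType d) (R : realType) (P : probability T R).

Lemma ae_eq_measure (A B : set T) : measurable A -> measurable B ->
  {ae P, forall w, A w <-> B w} -> P A = P B.
Proof.
move=> mA mB AB; rewrite -[A]setIT -[B]setIT -!integral_indic//.
apply: ge0_ae_eq_integral => //.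
- by apply/measurable_EFinP.
- by apply/measurable_EFinP.
- apply: filterS AB => w AB _; rewrite !indicE.
  suff -> : (w \in A) = (w \in B) by [].
  by apply/idP/idP; rewrite !inE => /AB.
Qed.

(** Independence makes the law of [(X, W)] a product. The event in question is a set [D] of this
    pair, and the product measure of [D] integrates over [y] the [nu]-measure of its section. *)
Lemma conditional_law_shift (X Y : {RV P >-> R}) (nu : probability R R) (a : R) :
  (forall A B, measurable A -> measurable B ->
     P (X @^-1` A `&` (fun w => Y w - a * X w) @^-1` B) = (P (X @^-1` A) * nu B)%E) ->
  conditional_law X Y (shift_kernel nu a).
Proof.
move=> indep A B mA mB; pose W w := Y w - a * X w.
have mW : measurable_fun setT W.
  by apply: measurable_funB => //; exact: measurable_funM.
have mXW : measurable_fun setT (fun w => (X w, W w)) by exact: measurable_fun_pair.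
pose D := [set p : R * R | B p.1 /\ A (p.2 + a * p.1)].
have mD : measurable D.
  have mf : measurable_fun setT (fun p : R * R => p.2 + a * p.1).
    by apply: measurable_funD => //; apply: measurable_funM.
  have m1 : measurable (fst @^-1` B : set (R * R)).
    by rewrite -[X in measurable X]setTI; exact: measurable_fst.
  have m2 : measurable ((fun p : R * R => p.2 + a * p.1) @^-1` A).
    by rewrite -[X in measurable X]setTI; exact: mf.
  exact: measurableI.
pose joint : {measure set (R * R) -> \bar R} := image_measure P mXW.
have jointE := @product_measure_unique _ _ _ _ _ (distribution P X) nu joint.
have {}jointE : joint D = ((distribution P X) \x nu)%E D.
  by apply/esym/jointE => // A' B' mA' mB'; exact: indep.
transitivity (joint D).
  rewrite /joint /= /pushforward; congr (P _); apply/seteqP; split => w /=.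
    by move=> [Bw Aw]; split=> //; rewrite /W subrK.
  by move=> [Bw]; rewrite /W subrK.
rewrite jointE /product_measure1 [RHS]integral_mkcond.
apply: eq_integral => y _; rewrite patchE /=; case: ifPn => yB.
  rewrite shift_kernelE; congr (nu _); apply/seteqP; split => x; rewrite /xsection/= inE.
    by case.
  by move=> Ax; split=> //; rewrite inE in yB.
rewrite (_ : xsection _ _ = set0) ?measure0//.
apply/seteqP; split => // x; rewrite /xsection/= inE => -[By _].
by move: yB; rewrite notin_setE.
Qed.

End conditional_law_shift.

Theorem corollary2p7 (R : realType) (d : measure_display)
  (T : measurableType d) (P : probability T R)
  (k lambda beta x0 : R) (n : nat) (X : R -> {RV P >-> R})
  (hk : 0 < k) (hlambda : 0 < lambda) (hbeta : 0 < beta)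
  (hn : (1 <= n)%N) (hkn : lambda / k = n%:R)
  (hX : gamma_OU k lambda beta x0 X)
  (s t : R) (hs : 0 <= s) (ht : 0 < t) :
  let a := expR (- (k * t)) in
  transition_density X s t (fun y => gd_shift (a * y) (g_density a n beta)).
Proof.
move=> a.
have lambdaE : lambda = k * n%:R by rewrite -hkn mulrC divfK// gt_eqF.
have a0 : 0 <= a := expR_ge0 _.
have a1 : a <= 1 by rewrite -[leRHS]expR0 ler_expR oppr_le0 mulr_ge0// ltW.
pose nu := mixture n a0 a1 hbeta.
exists (shift_kernel nu a); split; last first.
  by move=> y; exact: shift_kernel_gen_density.
apply: conditional_law_shift => A B mA mB.
pose U w := X s w - expR (- (k * s)) * x0.
pose W w := X (t + s) w - a * X s w.
have mU : measurable_fun setT U by exact: measurable_funB.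
have mW : measurable_fun setT W.
  by apply: measurable_funB => //; exact: measurable_funM.
have UW0 : {ae P, forall w, 0 <= U w /\ 0 <= W w}.
  have [N [J [jd sol]]] := hX.
  apply: filterS2 sol (compound_nondecreasing jd) => w xE [z0 zinc].
  have X0 : X 0 w = x0.
    by have [_ ->] := xE 0 (lexx 0); rewrite set_itv1 Rintegral_set1 z0; ring.
  have ts : s <= t + s by rewrite lerDr ltW.
  have /andP[B1 _] := OU_path_bounds hk xE zinc (lexx 0) hs.
  have /andP[B2 _] := OU_path_bounds hk xE zinc hs ts.
  split.
    move: B1; rewrite subr0 X0; apply: le_trans.
    by rewrite mulr_ge0 ?expR_ge0// subr_ge0 zinc.
  move: B2; rewrite addrK; apply: le_trans.
  by rewrite mulr_ge0 ?expR_ge0// subr_ge0 zinc.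
(* [laplace_independent] asks for nonnegativity at every [w], whereas [U] and [W] have it almost
   surely; positive parts repair this on a null set. *)
pose U' w := Num.max (U w) 0; pose W' w := Num.max (W w) 0.
have mU' : measurable_fun setT U' by exact: measurable_maxr.
have mW' : measurable_fun setT W' by exact: measurable_maxr.
have UW' : {ae P, forall w, U' w = U w /\ W' w = W w}.
  by apply: filterS UW0 => w [u0 w0]; rewrite /U' /W' !max_l.
have t0 := ltW ht.
have joint i j : (\int[P]_w (expR (- W' w) ^+ j * expR (- U' w) ^+ i)%:E =
    (laplace_factor k beta n s i%:R * laplace_factor k beta n t j%:R)%:E)%E.
  rewrite -(OU_laplace hk hbeta lambdaE hX)//; apply: ge0_ae_eq_integral => //.
  - apply/measurable_EFinP; apply: measurable_funM; apply: measurable_funX;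
      apply: measurableT_comp => //; exact: measurableT_comp.
  - apply/measurable_EFinP; apply: measurableT_comp => //; apply: measurableT_comp => //.
    by apply: measurable_funD; exact: measurable_funM.
  - apply: filterS UW' => w [-> ->] _; congr EFin.
    by rewrite -!expRM_natl -expRD; congr expR; rewrite /U /W /a; ring.
have laplaceE i j : (\int[P]_w (expR (- W' w) ^+ j * expR (- U' w) ^+ i)%:E =
    \int[P]_w (expR (- U' w) ^+ i)%:E *
    ((a ^+ n)%:E + \int[lebesgue_measure]_x
      (gd_reg (g_density a n beta) x * expR (- (j%:R * x)))%:E))%E.
  rewrite laplace_g_density// joint EFinM; congr (_ * _)%E.
  (* At [j = 0] the second factor is 1, which identifies the first as the transform of [U']
     alone. *)
  have := joint i 0%N; rewrite {2}/laplace_factor mul0r !addr0 divff ?gt_eqF//.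
  rewrite expr1n mulr1 => <-.
  by apply: eq_integral => w _; rewrite expr0 mul1r.
have max0 (x : R) : 0 <= Num.max x 0 by rewrite le_max lexx orbT.
have g_neg x : x < 0 -> gd_reg (g_density a n beta) x = 0.
  move=> xlt0; rewrite /= big1// => j _.
  by rewrite /erlang_pdf ltNge (ltW xlt0)/= mulr0.
have f0 := g_density_ge0 n a0 a1 hbeta.
have mf := measurable_g_density a beta n.
have total := g_density_total n a0 a1 hbeta.
have U'0 w : 0 <= U' w := max0 _.
have W'0 w : 0 <= W' w := max0 _.
have indep := laplace_independent mU' mW' U'0 W'0 (exprn_ge0 n a0) f0 mf total g_neg laplaceE.
(* [U] differs from [X s] by a constant, so events of [X s] are events of [U] for a translated
   set. *)
pose A' : set R := [set u | A (u + expR (- (k * s)) * x0)].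
have mA' : measurable A'.
  have mshift : measurable_fun setT (fun u : R => u + expR (- (k * s)) * x0).
    exact: measurable_funD.
  by rewrite -[A']setTI; exact: mshift.
have mpre (V : T -> R) D : measurable_fun setT V -> measurable D -> measurable (V @^-1` D).
  by move=> mV mD; rewrite -[X in measurable X]setTI; exact: mV.
have XA : X s @^-1` A = U @^-1` A'.
  by apply/seteqP; split => w; rewrite /A' /U /= subrK.
rewrite XA -/(W) (ae_eq_measure (B := U' @^-1` A' `&` W' @^-1` B)); last 3 first.
- by apply: measurableI; exact: mpre.
- by apply: measurableI; exact: mpre.
- by apply: filterS UW' => w [uE wE]; rewrite /= uE wE.
rewrite (ae_eq_measure (A := U @^-1` A') (B := U' @^-1` A')); last 3 first.
- exact: mpre.
- exact: mpre.
- by apply: filterS UW' => w [uE _]; rewrite /= uE.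
exact: indep.
Qed.
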